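(* Let $P_\lambda(n)$ be defined by $\sum_{n=0}^{\infty}P_\lambda(n)q^n=\lambda(q)$, where $\lambda(q)=\sum_{n=0}^{\infty}\dfrac{(-1)^nq^n(q;q^2)_n}{(-q;q)_n}$. Then for every integer $n\ge 0$, $$P_\lambda(2n)={P_\lambda}_{(d,e)}(n)-{P_\lambda}_{(d,o)}(n),$$ where ${P_\lambda}_{(d,e)}(n)$ (respectively ${P_\lambda}_{(d,o)}(n)$) denotes the number of partitions of $n$, all of whose parts are congruent to $0,1,3$ or $5\pmod 6$, such that (i) parts congruent to $1,5\pmod 6$ have three colours; (ii) parts congruent to $3\pmod 6$ have one colour; (iii) parts congruent to $0\pmod 6$ are distinct and have one colour; (iv) the number of parts congruent to $0\pmod 6$ is even (respectively odd).
   Context: Notation: $(b;q)_n=\prod_{k=0}^{n-1}(1-bq^k)$. Identities involving $q$ are between formal power series. Saying that a part has $r$ colours means that each part of that size may appear in any of $r$ distinct colours, and parts of the same size with different colours are considered distinct (colour partitions); parts may be repeated unless declared distinct. The empty partition is the only partition of $0$. *)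

(* Defs.v *)
From mathcomp Require Import all_boot all_order all_algebra.
Set Implicit Arguments.
Unset Strict Implicit.
Unset Printing Implicit Defensive.
Import GRing.Theory.
Local Open Scope ring_scope.

(* (b; q)_n = (1 - b) (1 - b q) ... (1 - b q^(n-1)) *)
Definition qpoch (R : comNzRingType) (b q : R) (n : nat) : R :=
  \prod_(k < n) (1 - b * q ^+ k).

(* A formal power series over the integers is its sequence of coefficients. *)
Definition fps := nat -> int.

(* p / d as a formal power series, for d with constant coefficient 1, obtained
   from 1 / d = \sum_j (1 - d)^j: the terms with j > m do not contribute to the
   m-th coefficient. See fps_divP and fps_div_unique. *)
Definition fps_div (p d : {poly int}) : fps :=
  fun m => (\sum_(j < m.+1) p * (1 - d) ^+ j)`_m.

(* The denominator has constant coefficient 1 (lambda_term_den). *)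
Definition lambda_term (n : nat) : fps :=
  fps_div ((-1) ^+ n * 'X^n * qpoch 'X ('X^2) n) (qpoch (- 'X) 'X n).

(* The n-th term of lambda(q) is divisible by q^n (lambda_term_small), so the sum
   giving the m-th coefficient stops at n = m. See also P_lambda_sum. *)
Definition P_lambda : fps := fun m => \sum_(n < m.+1) lambda_term n m.

Lemma coef_exp_small (e : {poly int}) (j i : nat) :
  e`_0 = 0 -> (i < j)%N -> (e ^+ j)`_i = 0.
Proof.
move=> e0 ij; have /factor_theorem[f ->] : root e 0.
  by rewrite /root horner_coef0 e0.
by rewrite subr0 exprMn_comm ?coefMXn ?ij //; apply: mulrC.
Qed.

Lemma coefM_small (a b : {poly int}) (j i : nat) :
  (forall k, (k < j)%N -> b`_k = 0) -> (i < j)%N -> (a * b)`_i = 0.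
Proof.
move=> b0 ij; rewrite coefM big1 // => k _.
by rewrite b0 ?mulr0 //; apply: leq_ltn_trans ij; apply: leq_subr.
Qed.

Lemma fps_div_trunc (p d : {poly int}) (m M : nat) :
  d`_0 = 1 -> (m <= M)%N ->
  (\sum_(j < M.+1) p * (1 - d) ^+ j)`_m = fps_div p d m.
Proof.
move=> d0 mM; rewrite /fps_div !coef_sum.
rewrite -!(big_mkord xpredT (fun j => (p * (1 - d) ^+ j)`_m)).
rewrite (@big_cat_nat _ _ _ m.+1) //=.
rewrite [X in _ + X](_ : _ = 0) ?addr0 //.
rewrite big_nat big1 // => j /andP[mj _]; apply: (@coefM_small _ _ j) => // k kj.
by apply: coef_exp_small => //; rewrite coefB coef1 d0 subrr.
Qed.

(* d * (p / d) = p as formal power series *)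
Lemma fps_divP (p d : {poly int}) : d`_0 = 1 ->
  forall m, \sum_(i < m.+1) d`_i * fps_div p d (m - i)%N = p`_m.
Proof.
move=> d0 m; set S := \sum_(j < m.+1) p * (1 - d) ^+ j.
have -> : \sum_(i < m.+1) d`_i * fps_div p d (m - i)%N = (d * S)`_m.
  rewrite coefM; apply: eq_bigr => i _.
  by rewrite /S (@fps_div_trunc p d (m - i)%N m) ?leq_subr.
have -> : d * S = p - p * (1 - d) ^+ m.+1.
  have := subrX1 (1 - d) m.+1; rewrite [1 - d - 1]addrAC subrr add0r mulNr => E.
  by rewrite /S -mulr_sumr mulrCA -[d * _]opprK -E opprB mulrBr mulr1.
rewrite coefB (@coefM_small _ _ m.+1) ?subr0 // => k km.
by apply: coef_exp_small => //; rewrite coefB coef1 d0 subrr.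
Qed.

Lemma fps_div_unique (p d : {poly int}) (s : fps) : d`_0 = 1 ->
  (forall m, \sum_(i < m.+1) d`_i * s (m - i)%N = p`_m) -> s =1 fps_div p d.
Proof.
move=> d0 sP m; elim/ltn_ind: m => m IH.
have := sP m; rewrite -(fps_divP p d0 m) !big_ord_recl d0 !mul1r !subn0.
rewrite (eq_bigr (fun i : 'I_m => d`_(lift ord0 i) *
  fps_div p d (m - lift ord0 i)%N)); first by move/addIr.
by move=> i _; rewrite IH //= /bump /= add1n; case: m i {IH} => [[]|m] // i;
  rewrite subSS ltnS leq_subr.
Qed.

Lemma lambda_term_den (n : nat) : (qpoch (- 'X : {poly int}) 'X n)`_0 = 1.
Proof.
rewrite -horner_coef0 /qpoch horner_prod big1 // => k _.
by rewrite hornerD hornerN hornerM hornerN hornerX oppr0 mul0r subr0 hornerC.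
Qed.

Lemma lambda_term_small (n m : nat) : (m < n)%N -> lambda_term n m = 0.
Proof.
move=> mn; rewrite /lambda_term /fps_div coef_sum big1 // => j _.
rewrite [_ * 'X^n]mulrC -!mulrA mulrC.
by apply: (@coefM_small _ _ n) => // k kn; rewrite coefXn ltn_eqF.
Qed.

(* The partial sums of lambda(q) converge coefficientwise to P_lambda. *)
Lemma P_lambda_sum (m N : nat) : (m < N)%N ->
  \sum_(n < N) lambda_term n m = P_lambda m.
Proof.
move=> mN; rewrite /P_lambda.
rewrite -!(big_mkord xpredT (fun n => lambda_term n m)).
rewrite (@big_cat_nat _ _ _ m.+1) //=.
rewrite [X in _ + X](_ : _ = 0) ?addr0 //.
by rewrite big_nat big1 // => n /andP[mn _]; apply: lambda_term_small.
Qed.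

Local Open Scope nat_scope.

(* Number of colours available for a part of size k; sizes congruent to 2 or 4
   modulo 6 have no colour, that is, they are not allowed as parts. *)
Definition ncolours (k : nat) : nat :=
  if (k == 1 %[mod 6]) || (k == 5 %[mod 6]) then 3
  else if (k == 3 %[mod 6]) || (k == 0 %[mod 6]) then 1
  else 0.

(* A coloured partition of n (a multiset of coloured parts) is encoded by its
   multiplicities: m (k, c) is the number of parts of size k and colour c.
   Sizes and multiplicities are bounded by n in any partition of n. *)
Definition multiplicities (n : nat) := {ffun 'I_n.+1 * 'I_3 -> 'I_n.+1}.

Definition is_colour_partition (n : nat) (m : multiplicities n) : bool :=
  [forall k : 'I_n.+1, forall c : 'I_3,
     (0 < m (k, c)) ==> (0 < k) && (c < ncolours k)]
  && (\sum_(k < n.+1) \sum_(c < 3) k * m (k, c) == n).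

Definition distinct_mod6_0 (n : nat) (m : multiplicities n) : bool :=
  [forall k : 'I_n.+1, forall c : 'I_3,
     (k == 0 %[mod 6]) ==> (m (k, c) <= 1)].

Definition nparts_mod6_0 (n : nat) (m : multiplicities n) : nat :=
  \sum_(k < n.+1 | k == 0 %[mod 6]) \sum_(c < 3) m (k, c).

Definition P_lambda_de (n : nat) : nat :=
  #|[set m : multiplicities n | [&& is_colour_partition m,
       distinct_mod6_0 m & ~~ odd (nparts_mod6_0 m)]]|.

Definition P_lambda_do (n : nat) : nat :=
  #|[set m : multiplicities n | [&& is_colour_partition m,
       distinct_mod6_0 m & odd (nparts_mod6_0 m)]]|.

(* Main.v *)
Require Import Defs.
From mathcomp Require Import all_boot all_order all_algebra.
From mathcomp Require Import zify ring qpoly.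
Set Implicit Arguments.
Unset Strict Implicit.
Unset Printing Implicit Defensive.
Import Order.TTheory GRing.Theory Num.Theory.
Local Open Scope ring_scope.

(** Write (a;q) for the infinite product of the factors 1 - a q^k, k >= 0.

    Bailey's lemma turns lambda into a Hecke-type double sum
    (lambda_sum_hecke):
      (q^2;q^2) lambda(q) = (q;q^2) H(q),
      H(q) = sum over r >= 0 and |j| <= r of (-1)^(r+j) q^(3r(r+1)/2 - j^2).
    Multiply H by the theta series of all (-1)^k q^(k^2) and put l = k + j.
    Since k^2 - j^2 = l^2 - 2lj, for fixed l <> 0 the sum over j is geometric
    and the remaining sum over r closes up to a full theta series, which is 0
    or plus or minus a monomial times (q;q); for l = 0 the sum is Jacobi's
    series for (q^3;q^3)^3. This gives (lambda_lambert)
      (q;q) (q^2;q^2) lambda(q) = (q^3;q^3)^3 + (q;q) L(q),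
    where L is the sum over l <> 0 of
      (-1)^l (l/3) q^((l^2+3l-1)/3) / (1 - q^(2l)), l read as |l|,
    and (l/3) is the Legendre symbol. The exponents (l^2+3l-1)/3 that occur are
    all odd, so L is an odd function (lambertN) and drops out of
    lambda(q) + lambda(-q). What is left is the even part of a product; Jacobi's
    triple product rewrites it as a sum of products of two theta series, and
    the change of variables (n, m) = (-(a+b), a-b) collapses that sum to a
    square (theta_product_sum). The outcome (even_part) is
      lambda(q) + lambda(-q)
        = 2 (q^12;q^12) / ((q^6;q^12) (q^2;q^12)^3 (q^10;q^12)^3),
    and with q in place of q^2 half of the right-hand side is the generating
    function of the coloured partitions counted with the sign of their number
    of parts divisible by 6 (part_gf_product).

    Power series modulo q^N are treated as elements of a commutative ring in
    which x is an element with x^N = 0. All sums and products are then finite,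
    the substitution q -> -q is the instance at - x of a statement proved for
    every such x, and the coefficients are recovered at the end from the class
    of the indeterminate in Z[X]/(X^N). *)

(** * Big operators compared along a bijection of supports *)

Section BigBij.
Variables (V : Type) (idx : V) (op : Monoid.com_law idx).

(** The index sets of truncated bilateral series are ranges, which a change of
    variables does not map onto each other; only the supports of the two
    families correspond. The predicates P and Q bound these supports. *)
Lemma big_support_bij (I J : eqType) (r : seq I) (s : seq J)
    (P : pred I) (Q : pred J) (F : I -> V) (G : J -> V) (h : I -> J) (k : J -> I) :
  uniq r -> uniq s ->
  (forall i, ~~ P i -> F i = idx) -> (forall j, ~~ Q j -> G j = idx) ->
  {in r, forall i, P i -> [/\ Q (h i), h i \in s, k (h i) = i & G (h i) = F i]} ->
  {in s, forall j, Q j -> [/\ P (k j), k j \in r & h (k j) = j]} ->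
  \big[op/idx]_(i <- r) F i = \big[op/idx]_(j <- s) G j.
Proof.
move=> ur us F0 G0 rP sP.
rewrite (bigID P) /= [X in op _ X]big1 ?Monoid.mulm1; last by move=> i /F0.
rewrite [RHS](bigID Q) /= [X in op _ X]big1 ?Monoid.mulm1; last by move=> j /G0.
rewrite -big_filter -[RHS]big_filter.
have -> : \big[op/idx]_(i <- [seq i <- r | P i]) F i =
          \big[op/idx]_(i <- [seq i <- r | P i]) G (h i).
  rewrite !big_seq; apply: eq_bigr => i; rewrite mem_filter => /andP[Pi ri].
  by have [] := rP i ri Pi.
rewrite -(big_map h xpredT G); apply: perm_big; apply: uniq_perm.
- rewrite map_inj_in_uniq ?filter_uniq // => i j.
  rewrite !mem_filter => /andP[Pi ri] /andP[Pj rj] e.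
  by have [_ _ <- _] := rP i ri Pi; have [_ _ <- _] := rP j rj Pj; rewrite e.
- by rewrite filter_uniq.
move=> j; rewrite mem_filter; apply/mapP/andP => [[i]|[Qj sj]].
  by rewrite mem_filter => /andP[Pi ri] ->; have [] := rP i ri Pi.
have [Pk rk hk] := sP j sj Qj.
by exists (k j); rewrite ?mem_filter ?Pk ?rk.
Qed.

End BigBij.

(** * q-products at a nilpotent element *)

Section Nilpotent.
Variables (R : comNzRingType) (N : nat).
Implicit Types x y q a b u v : R.

Lemma expr_nil_ge y k : y ^+ N = 0 -> (N <= k)%N -> y ^+ k = 0.
Proof. by move=> y0 /subnK <-; rewrite exprD y0 mulr0. Qed.

Lemma expr_nil_lt y k : y ^+ N = 0 -> y ^+ k != 0 -> (k < N)%N.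
Proof. by move=> y0; apply: contraNT; rewrite -leqNgt => /(expr_nil_ge y0)->. Qed.

Lemma nil_opp y : y ^+ N = 0 -> (- y) ^+ N = 0.
Proof. by move=> y0; rewrite exprNn y0 mulr0. Qed.

Lemma nil_mull a y : y ^+ N = 0 -> (a * y) ^+ N = 0.
Proof. by move=> y0; rewrite exprMn y0 mulr0. Qed.

Lemma nil_expS y k : y ^+ N = 0 -> (y ^+ k.+1) ^+ N = 0.
Proof. by move=> y0; rewrite exprS mulrC nil_mull. Qed.

(** The inverse of 1 - y when y^N = 0. *)
Definition geom y : R := \sum_(j < N) y ^+ j.

Lemma geomP y : y ^+ N = 0 -> (1 - y) * geom y = 1.
Proof. by move=> y0; have := subrX1 y N; rewrite y0 => e; rewrite -[LHS]opprK -mulNr opprB -e; ring. Qed.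

Lemma one_sub_reg y u v : y ^+ N = 0 -> (1 - y) * u = (1 - y) * v -> u = v.
Proof.
by move=> /geomP e E; rewrite -[u]mul1r -[v]mul1r -e ![_ * geom y]mulrC -!mulrA E.
Qed.

Lemma qpochS a q n : qpoch a q n.+1 = qpoch a q n * (1 - a * q ^+ n).
Proof. by rewrite /qpoch big_ord_recr. Qed.

(** For nilpotent a, the product is 1 plus a nilpotent element, hence
    cancellable: this is how quotients of infinite products are compared. *)
Lemma qpoch_reg a q n u v : a ^+ N = 0 ->
  qpoch a q n * u = qpoch a q n * v -> u = v.
Proof.
move=> a0; elim: n => [|n IH]; first by rewrite /qpoch big_ord0 !mul1r.
rewrite qpochS mulrAC [RHS]mulrAC ![_ * (1 - _)]mulrC.
by move/one_sub_reg => /(_ _)/IH; apply; rewrite mulrC nil_mull.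
Qed.

(** As q^N = 0, (a;q)_N plays the part of the infinite product (a;q). *)
Lemma qpoch_stable a q n : q ^+ N = 0 -> (N <= n)%N -> qpoch a q n = qpoch a q N.
Proof.
move=> q0 /subnK <-; elim: (n - N)%N => // m <-.
by rewrite addSn qpochS expr_nil_ge ?leq_addl // mulr0 subr0 mulr1.
Qed.

(** 1/(q;q)_n. *)
Definition inv_qfact q n : R := \prod_(k < n) geom (q ^+ k.+1).

Lemma inv_qfactP q n : q ^+ N = 0 -> qpoch q q n * inv_qfact q n = 1.
Proof.
move=> q0; elim: n => [|n IH]; first by rewrite /qpoch /inv_qfact !big_ord0 mulr1.
by rewrite /inv_qfact big_ord_recr qpochS mulrACA IH -exprS /= geomP ?nil_expS ?mulr1.
Qed.

Lemma inv_qfactS q n : q ^+ N = 0 -> inv_qfact q n = inv_qfact q n.+1 * (1 - q * q ^+ n).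
Proof.
by move=> q0; rewrite /inv_qfact big_ord_recr /= -mulrA [_ * (1 - _)]mulrC -exprS geomP ?nil_expS ?mulr1.
Qed.

Lemma inv_qfact_stable q n : q ^+ N = 0 -> (N <= n)%N -> inv_qfact q n = inv_qfact q N.
Proof.
move=> q0 Nn; apply: (@qpoch_reg q q N _ _ q0).
by rewrite inv_qfactP // -(qpoch_stable q q0 Nn) inv_qfactP.
Qed.

Lemma inv_qfact0 q : inv_qfact q 0 = 1. Proof. exact: big_ord0. Qed.

End Nilpotent.

Definition tri (n : nat) : nat := (n * n.+1)./2.

Lemma tri_mul2 n : (tri n * 2 = n * n.+1)%N.
Proof. by rewrite /tri muln2 halfK oddM /= andbN subn0. Qed.

Lemma triS n : tri n.+1 = (tri n + n.+1)%N.
Proof. have := tri_mul2 n; have := tri_mul2 n.+1; nia. Qed.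
Arguments tri : simpl never.

(** * A Bailey pair for 1/(-q;q)_n *)

Section Bailey.
Variables (R : comNzRingType) (N : nat) (x : R).
Hypothesis x0 : x ^+ N = 0.
Local Notation iq := (inv_qfact N x).

(** tau x r is the sum of (-1)^j x^(r^2 - j^2) over |j| <= r (see tauE); the
    factor x^(r^2) keeps all exponents nonnegative. *)
Fixpoint tau r : R :=
  if r is r'.+1 then x ^+ (r' + r').+1 * tau r' + 2 * (-1) ^+ r else 1.

(** With alpha_r = q^(r(3r+1)/2) (1 - q^(2r+1)) times the sum of the
    (-1)^j q^(-j^2), |j| <= r, these are the terms of the Bailey pair relation
    beta_n = sum of alpha_r / ((q;q)_(n-r) (q;q)_(n+r+1)) for
    beta_n = 1/(-q;q)_n. *)
Definition bailey_term n r : R :=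
  x ^+ tri r * (1 - x ^+ (r + r).+1) * tau r * iq (n - r) * iq (n + r).+1.

(** The summand is (1 + q^n) times the r-th term of beta_n minus the r-th term
    of beta_(n-1). Two telescopings are superposed in the closed form: a Gosper
    summation of the coefficient of tau, followed by summation by parts, which
    produces differences tau_(r+1) - q^(2r+1) tau_r = 2 (-1)^(r+1), and the
    alternating q-binomial sum that these leave behind. The latter has the
    denominator 1 - q^n, whence the factor geom. *)
Lemma bailey_telescope n m : (0 < n)%N -> (m <= n)%N ->
  \sum_(r < m) x ^+ tri r * (1 - x ^+ (r + r).+1) * tau r * iq (n - r) *
     ((1 + x ^+ n) * iq (n + r).+1 - (1 - x ^+ (n - r)) * iq (n + r)) =
  - (x ^+ tri m * x ^+ (n - m) * (1 + x ^+ m) * iq (n - m) * iq (n + m) * tau m)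
  + 2 * x ^+ n * (-1) ^+ m * x ^+ tri m * (1 - x ^+ (n - m)) * iq (n - m) *
    iq (n + m) * geom N (x ^+ n).
Proof.
move=> n0; have gP : (1 - x ^+ n) * geom N (x ^+ n) = 1.
  by case: n n0 => // n _; rewrite geomP ?nil_expS.
elim: m => [_|m IH mn].
  rewrite big_ord0 /= !addn0 !subn0 expr0 !mulr1 !mul1r.
  transitivity (2 * x ^+ n * iq n * iq n * ((1 - x ^+ n) * geom N (x ^+ n) - 1)).
    by rewrite gP subrr mulr0.
  by ring.
rewrite big_ord_recr /= IH ?(ltnW mn) //.
(* All powers become monomials in x, x^m and x^k with n = m + k + 1. *)
have [k nE] : exists k, n = (m + k).+1 by exists (n - m.+1)%N; lia.
rewrite nE in gP *.
have -> : ((m + k).+1 - m = k.+1)%N by lia.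
have -> : ((m + k).+1 - m.+1 = k)%N by lia.
rewrite (inv_qfactS k x0) addnS (inv_qfactS ((m + k).+1 + m) x0) triS.
move: gP; move: (geom _ _) => g; rewrite !(exprD, exprS) => gP.
move: (iq k.+1) (iq ((m + k).+1 + m).+1) (x ^+ tri m) (x ^+ m) (x ^+ k) ((-1) ^+ m) (tau m) gP.
move=> I J t a b s ta gP.
apply/eqP; rewrite -subr_eq0; apply/eqP.
(* The two sides differ by a multiple of (1 - x^n) geom(x^n) - 1. *)
transitivity (2 * s * t * a * x * b * I * J * (1 - x * b) * (1 + x * a)
  * ((1 - x * (a * b)) * g - 1)); last by rewrite gP subrr mulr0.
ring.
Qed.

(** By bailey_telescope the sum satisfies (1 + q^n) beta_n = beta_(n-1). *)
Lemma bailey_pair n : qpoch (- x) x n * \sum_(r < n.+1) bailey_term n r = 1.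
Proof.
elim: n => [|n IH].
  rewrite big_ord_recl big_ord0 /bailey_term /qpoch big_ord0 /= inv_qfact0 !expr0.
  by have := inv_qfactP 1 x0; rewrite qpochS /qpoch big_ord0 expr0 !mul1r !mulr1 addr0.
rewrite qpochS -[RHS]IH -mulrA; congr (_ * _).
have := bailey_telescope (ltn0Sn n) (leqnn n.+1).
set S := \sum_(_ < _) _ => SE.
have SE2 : (1 + x ^+ n.+1) * (\sum_(r < n.+1) bailey_term n.+1 r) = S + \sum_(r < n.+1) bailey_term n r.
  rewrite mulr_sumr -big_split; apply: eq_bigr => -[r rn] _ /=.
  rewrite /bailey_term.
  rewrite (inv_qfactS (n - r) x0) -exprS -subSn // addSn.
  by move: (x ^+ n.+1) (x ^+ (n.+1 - r)) (x ^+ (r + r).+1) => *; ring.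
rewrite big_ord_recr mulrDr mulNr opprK -exprS SE2 SE /bailey_term.
rewrite !subnn !inv_qfact0 (inv_qfactS (n.+1 + n.+1) x0) -exprS expr0 subrr !(mulr0, mul0r) addr0.
by rewrite addrAC -[RHS]add0r; congr (_ + _); ring.
Qed.

End Bailey.

(** * The Hecke-type expansion of lambda *)

Section Kernel.
Variables (R : comNzRingType) (N : nat) (x : R).
Hypothesis x0 : x ^+ N = 0.
Local Notation iq := (inv_qfact N x).

Lemma nilpotent_order_gt0 : (0 < N)%N.
Proof. by case: N x0 => // /eqP; rewrite oner_eq0. Qed.

(** Euler's expansion of 1/(z;q): both sides are governed by
    (1 - z) E(z) = E(zq). *)
Lemma euler_sum (z : R) : z ^+ N = 0 ->
  qpoch z x N * (\sum_(m < N) z ^+ m * iq m) = 1.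
Proof.
move=> z0; pose E u := \sum_(m < N) u ^+ m * iq m.
have step u : u ^+ N = 0 -> (1 - u) * E u = E (u * x).
  move=> u0; rewrite mulrBl mul1r; apply/eqP; rewrite subr_eq addrC -subr_eq; apply/eqP.
  rewrite /E mulr_sumr -sumrB.
  case: N nilpotent_order_gt0 u0 x0 => // M _ u0 x0M.
  rewrite big_ord_recl [RHS]big_ord_recr /= !expr0 subrr add0r mulrA -exprS u0 mul0r addr0.
  apply: eq_bigr => i _; rewrite /bump add1n (inv_qfactS i x0M) exprMn !exprS; ring.
have it n : qpoch z x n * E z = E (z * x ^+ n).
  elim: n => [|n IH]; first by rewrite /qpoch big_ord0 mul1r mulr1.
  by rewrite qpochS mulrAC IH mulrC step ?exprSr ?mulrA // mulrC nil_mull.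
rewrite it x0 mulr0 /E.
case: N nilpotent_order_gt0 => // M _.
rewrite big_ord_recl expr0 inv_qfact0 mulr1 big1 ?addr0 // => i _.
by rewrite exprS !mul0r.
Qed.

(** Up to trivial factors, the coefficient of alpha_r after exchanging the two
    summations in Bailey's lemma; an instance of the q-Gauss sum. *)
Definition kernel_sum r : R := \sum_(m < N)
  (- x) ^+ m * qpoch x (x ^+ 2) (m + r) * iq m * iq (m + r + r).+1.

(** A Gosper certificate in m: passing from r to r + 1 multiplies kernel_sum by
    (1 - q^(2r+1)) / (1 - q^(2r+3)). *)
Lemma kernel_telescope r M :
  \sum_(m < M) ((1 - x * x ^+ r ^+ 2) *
     ((- x) ^+ m * qpoch x (x ^+ 2) (m + r) * iq m * iq (m + r + r).+1)
   - (1 - x ^+ 3 * x ^+ r ^+ 2) *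
     ((- x) ^+ m * qpoch x (x ^+ 2) (m + r).+1 * iq m * iq (m + r + r).+3)) =
  (- x) ^+ M * qpoch x (x ^+ 2) (M + r) * iq M * (1 - x ^+ M) *
  iq (M + r + r).+2 * x * x ^+ r ^+ 2 * ((1 - x) + (1 - x ^+ 2 * x ^+ r ^+ 2) * x ^+ M).
Proof.
elim: M => [|M IH]; first by rewrite big_ord0 expr0 subrr !(mulr0, mul0r).
rewrite big_ord_recr IH /= !addSn (inv_qfactS M x0).
rewrite (inv_qfactS (M + r + r).+1 x0) (inv_qfactS (M + r + r).+2 x0) qpochS.
rewrite -[x ^+ 2 ^+ (M + r)]exprM mulnC muln2 -addnn !(exprS, exprD) expr0.
move: (iq M.+1) (iq _.+3) (qpoch _ _ _) (x ^+ r) (x ^+ M) ((- x) ^+ M) => *.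
ring.
Qed.

Lemma kernel_sumS r :
  (1 - x ^+ (r + r).+1) * kernel_sum r = (1 - x ^+ (r.+1 + r.+1).+1) * kernel_sum r.+1.
Proof.
apply/eqP; rewrite -subr_eq0 /kernel_sum !mulr_sumr -sumrB; apply/eqP.
rewrite -[RHS](_ : (- x) ^+ N * qpoch x (x ^+ 2) (N + r) * iq N * (1 - x ^+ N) *
  iq (N + r + r).+2 * x * x ^+ r ^+ 2 * ((1 - x) + (1 - x ^+ 2 * x ^+ r ^+ 2) * x ^+ N) = 0); last first.
  by rewrite (nil_opp x0) !mul0r.
rewrite -kernel_telescope; apply: eq_bigr => m _.
rewrite !addnS !addSn !(exprS, exprD) expr0.
move: (x ^+ r) => ?; ring.
Qed.

(** By kernel_sumS the left-hand side does not depend on r, and for r >= N it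
    degenerates, because q^r = 0, to Euler's series. *)
Lemma kernel_sumE r :
  (1 - x ^+ (r + r).+1) * kernel_sum r =
  qpoch x (x ^+ 2) N * iq N * \sum_(m < N) (- x) ^+ m * iq m.
Proof.
have const s : (1 - x ^+ (s + s).+1) * kernel_sum s = (1 - x ^+ 1) * kernel_sum 0.
  by elim: s => // s <-; rewrite (kernel_sumS s).
(* The constant is evaluated at r = N. *)
rewrite const -(const N) (expr_nil_ge x0) ?subr0 ?mul1r; last by lia.
rewrite /kernel_sum mulr_sumr; apply: eq_bigr => m _.
rewrite (qpoch_stable _ (nil_expS 1 x0)) ?(inv_qfact_stable x0 (n := (m + N + N).+1)); first by ring.
  by lia.
by lia.
Qed.

(** lambda(x); the inverse of (-x;x)_n is the geometric series of
    1 - (-x;x)_n, as in fps_div. *)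
Definition lambda_sum : R := \sum_(n < N)
  (- x) ^+ n * qpoch x (x ^+ 2) n * geom N (1 - qpoch (- x) x n).

(** The exponent is that of 3r(r+1)/2 - j^2 without the part r^2 - j^2
    already contained in tau. *)
Definition hecke_sum : R := \sum_(r < N) (-1) ^+ r * x ^+ (tri r + r) * tau x r.

Lemma qpoch_sub1_nil n : (1 - qpoch (- x) x n) ^+ N = 0.
Proof.
have [t ->] : exists t, 1 - qpoch (- x) x n = t * x.
  elim: n => [|n [t IH]]; first by exists 0; rewrite /qpoch big_ord0 subrr mul0r.
  exists (t - qpoch (- x) x n * x ^+ n); rewrite qpochS mulrBl -IH; ring.
exact: nil_mull.
Qed.

Lemma lambda_sum_bailey : lambda_sum = \sum_(n < N)
  (- x) ^+ n * qpoch x (x ^+ 2) n * (\sum_(r < n.+1) bailey_term N x n r).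
Proof.
apply: eq_bigr => n _; congr (_ * _).
have := geomP (qpoch_sub1_nil n); rewrite opprB addrC subrK.
have := bailey_pair x0 n; move: (qpoch (- x) x n) (geom _ _) (\sum_(_ < _) _).
by move=> w v u wu wv; rewrite -[u]mul1r -wv mulrAC wu mul1r.
Qed.

(** Exchange of summations over r <= n with n = m + r; the vanishing for large
    n makes the triangle a square. *)
Lemma sum_triangle (F : nat -> nat -> R) :
  (forall n r, (N <= n)%N -> F n r = 0) ->
  \sum_(n < N) \sum_(r < n.+1) F n r = \sum_(r < N) \sum_(m < N) F (m + r)%N r.
Proof.
move=> F0.
transitivity (\sum_(n < N) \sum_(r < N | (r < n.+1)%N) F n r).
  by apply: eq_bigr => n _; rewrite -big_ord_widen.
rewrite (exchange_big_dep xpredT) //=; apply: eq_bigr => r _.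
rewrite -(big_mkord xpredT (fun m => F (m + r)%N r)).
rewrite -(big_mkord (fun n => r < n.+1)%N (fun n => F n r)).
have := @big_addn _ 0 +%R 0 (N + r) r xpredT (fun n => F n r).
rewrite addnK /= => <-.
have rN := ltn_ord r.
rewrite (@big_cat_nat _ _ _ r 0 N) ?(ltnW rN) //= big_nat_cond big1 ?add0r; last first.
  by move=> i; lia.
rewrite (@big_cat_nat _ _ _ N (0 + r)%N (N + r)%N) /=; [|by lia|by lia].
rewrite [X in _ = _ + X]big_nat_cond [X in _ = _ + X]big1 ?addr0; last first.
  by move=> i /andP[/andP[Ni _] _]; exact: F0.
rewrite add0n big_nat_cond [RHS]big_nat_cond; apply: eq_bigl => i; lia.
Qed.

(** Bailey's lemma: in the sum over m = n - r, kernel_sumE isolates the whole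
    dependence on r. *)
Lemma lambda_sum_hecke : qpoch (x ^+ 2) (x ^+ 2) N * lambda_sum = qpoch x (x ^+ 2) N * hecke_sum.
Proof.
rewrite lambda_sum_bailey.
pose F n r := (- x) ^+ n * qpoch x (x ^+ 2) n * bailey_term N x n r.
transitivity (qpoch (x ^+ 2) (x ^+ 2) N * \sum_(n < N) \sum_(r < n.+1) F n r).
  by congr (_ * _); apply: eq_bigr => n _; rewrite mulr_sumr.
rewrite sum_triangle; last first.
  by move=> n r Nn; rewrite /F (expr_nil_ge (nil_opp x0)) ?mul0r.
have -> : qpoch (x ^+ 2) (x ^+ 2) N = qpoch x x N * qpoch (- x) x N.
  rewrite /qpoch -big_split; apply: eq_bigr => k _ /=.
  by rewrite exprAC; ring.
rewrite /hecke_sum !mulr_sumr; apply: eq_bigr => r _.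
transitivity (qpoch x x N * qpoch (- x) x N *
   ((- x) ^+ r * x ^+ tri r * tau x r * ((1 - x ^+ (r + r).+1) * kernel_sum r))).
  rewrite /kernel_sum !mulr_sumr; apply: eq_bigr => m _.
  by rewrite /F /bailey_term addnK exprD; ring.
rewrite kernel_sumE [(- x) ^+ r]exprNn exprD.
have := inv_qfactP N x0; have := euler_sum (nil_opp x0).
move: (qpoch x x N) (iq N) (qpoch (- x) x N) (\sum_(m < N) _) => u v w z e1 e2.
transitivity ((u * v) * (w * z) * ((-1) ^+ r * x ^+ r * x ^+ tri r * tau x r * qpoch x (x ^+ 2) N)).
  by ring.
by rewrite e1 e2 !mul1r; ring.
Qed.

End Kernel.

(** * Triangular numbers and bilateral sums *)

(** The triangular number n(n+1)/2 of an integer n, which takes the same value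
    at k and -k-1. *)
Definition triz (n : int) : nat := match n with Posz k => tri k | Negz k => tri k end.

Lemma triz_mul2 (n : int) : (triz n)%:Z * 2 = n * (n + 1).
Proof. case: n => k /=; have := tri_mul2 k; nia. Qed.

Lemma triz_pred (n : int) : (triz n)%:Z = (triz (n - 1))%:Z + n.
Proof. have := triz_mul2 n; have := triz_mul2 (n - 1); nia. Qed.

Lemma triz_succ (n : int) : (triz (n + 1))%:Z = (triz n)%:Z + n + 1.
Proof. have := triz_mul2 n; have := triz_mul2 (n + 1); nia. Qed.

(** The interval -M <= n < M, symmetric under n -> -1-n like triz. *)
Definition zrange (M : nat) : seq int :=
  [seq Posz k | k <- index_iota 0 M] ++ [seq Negz k | k <- index_iota 0 M].

Lemma mem_zrange M (n : int) : (n \in zrange M) = (- M%:Z <= n < M%:Z).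
Proof.
rewrite mem_cat; apply/orP/idP => [[/mapP[k]|/mapP[k]]|].
- rewrite mem_index_iota => kM ->; lia.
- rewrite mem_index_iota => kM ->; lia.
case: n => k kM; [left|right]; apply/mapP; exists k => //; rewrite mem_index_iota; lia.
Qed.

Lemma zrange_uniq M : uniq (zrange M).
Proof.
rewrite cat_uniq !map_inj_uniq ?iota_uniq /= ?andbT; last by move=> ? ? [].
  by apply/hasPn => _ /mapP[k _ ->]; apply/negP => /mapP[].
by move=> ? ? [].
Qed.

Lemma triz_range M (n : int) : (triz n < M)%N -> n \in zrange M.
Proof. rewrite mem_zrange; have := triz_mul2 n; nia. Qed.

(** * Jacobi's triple product and cube identities *)

Section Theta.
Variables (R : comNzRingType).
Implicit Types (F : int -> R).

Lemma zsum_split M F :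
  \sum_(n <- zrange M) F n = \sum_(k < M) (F k%:Z + F (Negz k)).
Proof.
by rewrite big_cat /= !big_map !big_mkord big_split.
Qed.

Definition zsign (n : int) : R := (-1) ^+ absz n.

Lemma zsignD n m : zsign (n + m) = zsign n * zsign m.
Proof.
rewrite /zsign -exprD -signr_odd -[RHS]signr_odd; congr (_ ^+ nat_of_bool _); lia.
Qed.

Variable N : nat.
Implicit Types (q a b : R).

Definition gauss_bin q n k : R :=
  if (k <= n)%N then qpoch q q n * inv_qfact N q k * inv_qfact N q (n - k) else 0.

Lemma gauss_bin0 q n : q ^+ N = 0 -> gauss_bin q n 0 = 1.
Proof. by move=> q0; rewrite /gauss_bin inv_qfact0 subn0 mulr1 inv_qfactP. Qed.

Lemma gauss_bin_small q n k : (n < k)%N -> gauss_bin q n k = 0.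
Proof. by move=> nk; rewrite /gauss_bin leqNgt nk. Qed.

Lemma gauss_binn q n : q ^+ N = 0 -> gauss_bin q n n = 1.
Proof. by move=> q0; rewrite /gauss_bin leqnn subnn inv_qfact0 mulr1 inv_qfactP. Qed.

Lemma gauss_pascal q n k : q ^+ N = 0 -> (k <= n)%N ->
  gauss_bin q n.+1 k.+1 = gauss_bin q n k.+1 + q ^+ (n - k) * gauss_bin q n k /\
  gauss_bin q n.+1 k.+1 = q ^+ k.+1 * gauss_bin q n k.+1 + gauss_bin q n k.
Proof.
move=> q0; rewrite leq_eqVlt => /orP[/eqP->|kn].
  by rewrite !gauss_binn // gauss_bin_small // subnn; split; ring.
have [j nE] : exists j, n = (k + j).+1 by exists (n - k.+1)%N; lia.
rewrite /gauss_bin (ltnW kn) kn ltnS (ltnW kn) subSS qpochS.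
have -> : (n - k = j.+1)%N by lia.
have -> : (n - k.+1 = j)%N by lia.
rewrite (inv_qfactS k q0) (inv_qfactS j q0) nE !(exprS, exprD).
move: (inv_qfact _ _ _) (inv_qfact _ _ _) (qpoch _ _ _) (q ^+ k) (q ^+ j) => I J u c d.
by split; ring.
Qed.

Lemma gauss_sum1 q n (u : nat -> R) : q ^+ N = 0 ->
  \sum_(k < n.+2) gauss_bin q n.+1 k * u k =
  \sum_(k < n.+1) gauss_bin q n k * (u k + q ^+ (n - k) * u k.+1).
Proof.
move=> q0; under [RHS]eq_bigr do rewrite mulrDr.
rewrite big_split big_ord_recl [X in _ = X + _]big_ord_recl /= !gauss_bin0 //.
rewrite -addrA; congr (_ + _).
rewrite [X in _ = X + _](_ : _ = \sum_(k < n.+1) gauss_bin q n k.+1 * u k.+1).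
  rewrite -big_split; apply: eq_bigr => k _ /=; rewrite /bump add1n.
  by have [-> _] := gauss_pascal q0 (ltn_ord k : (k <= n)%N); ring.
by rewrite [RHS]big_ord_recr /= gauss_bin_small // mul0r addr0.
Qed.

Lemma gauss_sum2 q n (u : nat -> R) : q ^+ N = 0 ->
  \sum_(k < n.+2) gauss_bin q n.+1 k * u k =
  \sum_(k < n.+1) gauss_bin q n k * (q ^+ k * u k + u k.+1).
Proof.
move=> q0; under [RHS]eq_bigr do rewrite mulrDr.
rewrite big_split big_ord_recl [X in _ = X + _]big_ord_recl /= !gauss_bin0 //.
rewrite expr0 !mul1r -addrA; congr (_ + _).
rewrite [X in _ = X + _](_ : _ = \sum_(k < n.+1) gauss_bin q n k.+1 * (q ^+ k.+1 * u k.+1)).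
  rewrite -big_split; apply: eq_bigr => k _ /=; rewrite /bump add1n.
  by have [_ ->] := gauss_pascal q0 (ltn_ord k : (k <= n)%N); ring.
by rewrite [RHS]big_ord_recr /= gauss_bin_small // mul0r addr0.
Qed.

(** The central coefficients of a long row all equal 1/(q;q): letting the row
    grow turns a finite identity into one for bilateral series. *)
Lemma gauss_limit q M c F : q ^+ N = 0 -> (N + N <= c)%N -> (c + N + N <= M)%N ->
  (forall n, n \notin zrange N -> F n = 0) ->
  qpoch q q N * (\sum_(k < M.+1) gauss_bin q M k * F (k%:Z - c%:Z)) =
  \sum_(n <- zrange N) F n.
Proof.
move=> q0 Nc cM F0; rewrite mulr_sumr.
transitivity (\sum_(k < M.+1) F (k%:Z - c%:Z)).
  apply: eq_bigr => k _.
  have [kr|/F0->] := boolP (k%:Z - c%:Z \in zrange N); last by rewrite !mulr0.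
  have kM : (k <= M)%N by have := ltn_ord k; lia.
  move: kr; rewrite mem_zrange /gauss_bin kM => kr.
  rewrite (qpoch_stable q q0) ?(inv_qfact_stable q0 (n := k)) ?(inv_qfact_stable q0 (n := (M - k)%N)); try lia.
  have := inv_qfactP N q0; move: (qpoch _ _ _) (inv_qfact _ _ _) (F _) => u v w uv.
  by transitivity (u * v * (u * v) * w); [ring | rewrite uv !mul1r].
rewrite -(big_mkord xpredT (fun k => F (k%:Z - c%:Z))).
apply: (@big_support_bij _ _ _ _ _ _ _ [pred k : nat | k%:Z - c%:Z \in zrange N]
   (mem (zrange N)) _ _ (fun k => k%:Z - c%:Z) (fun n => absz (n + c%:Z))).
- exact: iota_uniq.
- exact: zrange_uniq.
- by move=> k /= /F0.
- by move=> n /= /F0.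
- by move=> k /= _ kr; split => //; lia.
- move=> n /= nr _; move: (nr); rewrite mem_zrange mem_index_iota => nr'.
  have e : (absz (n + c%:Z))%:Z - c%:Z = n by lia.
  by rewrite e nr; split => //; lia.
Qed.

(** Ramanujan's parametrisation: the terms of the theta function f(a,b), with
    q = ab, only involve nonnegative powers. *)
Definition theta_term a b (n : int) : R := a ^+ triz n * b ^+ triz (n - 1).

Lemma theta_term_succ a b m (k : nat) : (k <= m + m)%N ->
  a * (a * b) ^+ m * theta_term a b (k%:Z - m%:Z) =
  (a * b) ^+ (m + m - k) * theta_term a b (k.+1%:Z - m%:Z).
Proof.
move=> km; rewrite /theta_term; set n := k%:Z - m%:Z.
have -> : k.+1%:Z - m%:Z = n + 1 by rewrite /n; lia.
rewrite addrK !exprMn.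
have -> : a * (a ^+ m * b ^+ m) * (a ^+ triz n * b ^+ triz (n - 1)) =
  a ^+ (1 + m + triz n) * b ^+ (m + triz (n - 1)).
  by rewrite !exprD expr1; ring.
have -> : (1 + m + triz n = m + m - k + triz (n + 1))%N.
  by have := triz_succ n; rewrite /n; lia.
have -> : (m + triz (n - 1) = m + m - k + triz n)%N.
  by have := triz_pred n; rewrite /n; lia.
by rewrite !exprD; ring.
Qed.

Lemma theta_term_pred a b m (k : nat) :
  b * (a * b) ^+ m * theta_term a b (k%:Z - m%:Z) =
  (a * b) ^+ k * theta_term a b (k%:Z - m.+1%:Z).
Proof.
rewrite /theta_term; set n := k%:Z - m%:Z.
have -> : k%:Z - m.+1%:Z = n - 1 by rewrite /n; lia.
rewrite !exprMn.
have -> : b * (a ^+ m * b ^+ m) * (a ^+ triz n * b ^+ triz (n - 1)) =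
  a ^+ (m + triz n) * b ^+ (1 + m + triz (n - 1)).
  by rewrite !exprD expr1; ring.
have -> : (m + triz n = k + triz (n - 1))%N.
  by have := triz_pred n; rewrite /n; lia.
have -> : (1 + m + triz (n - 1) = k + triz (n - 1 - 1))%N.
  by have := triz_pred (n - 1); rewrite /n; lia.
by rewrite !exprD; ring.
Qed.

(** The two new factors of the product are absorbed one at a time by the two
    forms of Pascal's rule. *)
Lemma finite_triple_product a b m : (a * b) ^+ N = 0 ->
  qpoch (- a) (a * b) m * qpoch (- b) (a * b) m =
  \sum_(k < (m + m).+1) gauss_bin (a * b) (m + m) k * theta_term a b (k%:Z - m%:Z).
Proof.
move=> q0; elim: m => [|m IH].
  rewrite big_ord_recl big_ord0 gauss_bin0 // /qpoch !big_ord0 subrr /theta_term /= !expr0.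
  by ring.
rewrite !qpochS addSn addnS.
rewrite (@gauss_sum2 _ _ (fun k => theta_term a b (k%:Z - m.+1%:Z))) //.
transitivity ((1 + b * (a * b) ^+ m) * \sum_(k < (m + m).+2)
   gauss_bin (a * b) (m + m).+1 k * theta_term a b (k%:Z - m%:Z)).
  rewrite (@gauss_sum1 _ _ (fun k => theta_term a b (k%:Z - m%:Z))) //.
  transitivity ((1 + b * (a * b) ^+ m) * ((1 + a * (a * b) ^+ m) *
    (qpoch (- a) (a * b) m * qpoch (- b) (a * b) m))); first by ring.
  rewrite IH; congr (_ * _); rewrite mulr_sumr; apply: eq_bigr => k _.
  rewrite -theta_term_succ; first by ring.
  by have := ltn_ord k; lia.
rewrite mulr_sumr; apply: eq_bigr => k _.
rewrite -theta_term_pred.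
have -> : k.+1%:Z - m.+1%:Z = k%:Z - m%:Z by lia.
by ring.
Qed.

Lemma triple_product a b : a ^+ N = 0 -> b ^+ N = 0 ->
  qpoch (- a) (a * b) N * qpoch (- b) (a * b) N * qpoch (a * b) (a * b) N =
  \sum_(n <- zrange N) theta_term a b n.
Proof.
move=> a0 b0; have q0 : (a * b) ^+ N = 0 by rewrite nil_mull.
(* Row 4N, centred at 2N: the support |n| <= N stays at distance N from both
   ends of the row. *)
rewrite -(@gauss_limit _ (N + N + (N + N)) (N + N) _ q0); try lia; last first.
  move=> n; apply: contraNeq => t0; apply: triz_range.
  by apply: (expr_nil_lt a0); apply: contraNneq t0; rewrite /theta_term => ->; rewrite mul0r.
rewrite -finite_triple_product // mulrC; congr (_ * _).
by rewrite !(qpoch_stable _ q0) ?leq_addr.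
Qed.

(** The derivative at z = 1 of the n-th term of the triple product series. *)
Definition cube_term q (n : int) : R := zsign n * n%:~R * q ^+ triz n.

(** Two applications of Pascal's rule multiply the sum by (1 - q^(m+1))^2,
    already term by term: the second difference of n is zero. *)
Lemma finite_jacobi_cube q m : q ^+ N = 0 ->
  \sum_(k < (m + m).+2) gauss_bin q (m + m).+1 k * cube_term q (k%:Z - m.+1%:Z) = qpoch q q m ^+ 2.
Proof.
move=> q0; elim: m => [|m IH].
  rewrite !big_ord_recl big_ord0 gauss_bin0 // gauss_binn // /qpoch big_ord0 /cube_term /=.
  rewrite sub0r subrr /zsign /=; ring.
rewrite addSn addnS (@gauss_sum1 _ _ (fun k => cube_term q (k%:Z - m.+2%:Z))) //.
rewrite (@gauss_sum2 _ _ (fun k => cube_term q (k%:Z - m.+2%:Z) +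
   q ^+ ((m + m).+2 - k) * cube_term q (k.+1%:Z - m.+2%:Z))) //.
rewrite qpochS exprMn -IH mulr_suml; apply: eq_bigr => k _.
rewrite -mulrA; congr (_ * _); set n := k%:Z - m.+1%:Z.
have kM : (k <= (m + m).+1)%N by have := ltn_ord k; lia.
have -> : k%:Z - m.+2%:Z = n - 1 by rewrite /n; lia.
have -> : k.+1%:Z - m.+2%:Z = n by rewrite /n; lia.
have -> : k.+2%:Z - m.+2%:Z = n + 1 by rewrite /n; lia.
rewrite /cube_term (zsignD n) (zsignD n 1) [(n - 1)%:~R]intrD [(n + 1)%:~R]intrD.
have e1 : q ^+ k * q ^+ triz (n - 1) = q * q ^+ m * q ^+ triz n.
  by rewrite -exprS -!exprD; congr (_ ^+ _); have := triz_pred n; rewrite /n; lia.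
have e2 : q ^+ ((m + m).+2 - k.+1) * q ^+ triz (n + 1) = q * q ^+ m * q ^+ triz n.
  by rewrite -exprS -!exprD; congr (_ ^+ _); have := triz_succ n; rewrite /n; lia.
have e3 : q ^+ k * q ^+ ((m + m).+2 - k) = (q * q ^+ m) ^+ 2.
  by rewrite -exprS -exprM -!exprD; congr (_ ^+ _); lia.
have -> : zsign 1 = -1 by rewrite /zsign.
have -> : zsign (-1) = -1 by rewrite /zsign.
transitivity (zsign n * - (n%:~R - 1) * (q ^+ k * q ^+ triz (n - 1)) +
  zsign n * n%:~R * q ^+ triz n * (1 + q ^+ k * q ^+ ((m + m).+2 - k)) -
  zsign n * (n%:~R + 1) * (q ^+ ((m + m).+2 - k.+1) * q ^+ triz (n + 1))).
  rewrite (_ : (-1)%:~R = -1 :> R) // (_ : 1%:~R = 1 :> R) //.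
  ring.
rewrite e1 e2 e3; ring.
Qed.

(** In the limit of finite_jacobi_cube, the terms n = k and n = -1-k have the
    same power of q and coefficients adding up to (-1)^k (2k+1). *)
Lemma jacobi_cube q : q ^+ N = 0 ->
  \sum_(k < N) (-1) ^+ k * (k + k).+1%:R * q ^+ tri k = qpoch q q N ^+ 3.
Proof.
move=> q0; have := finite_jacobi_cube (N + N) q0.
rewrite (qpoch_stable q q0) ?leq_addr // => e.
rewrite [RHS]exprS -e (@gauss_limit _ _ (N + N).+1 (cube_term q)) //; try lia; last first.
  move=> n; apply: contraNeq => t0; apply: triz_range.
  by apply: (expr_nil_lt q0); apply: contraNneq t0; rewrite /cube_term => ->; rewrite mulr0.
rewrite zsum_split; apply: eq_bigr => k _.
rewrite /cube_term /zsign /= NegzE exprS intrN -addnS natrD; ring.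
Qed.

End Theta.

(** * Resolution of the Hecke sum into theta series *)

Section HeckeTheta.
Variables (R : comNzRingType) (N : nat).
Implicit Types x : R.
Local Notation zsign := (zsign R).

Lemma triz_square (n : int) : (triz n + triz (n - 1) = absz (n * n)%R)%N.
Proof.
have := triz_mul2 n; have := triz_pred n; have : 0 <= n * n by rewrite -expr2 sqr_ge0.
by rewrite mulrDr mulr1; lia.
Qed.

Lemma theta_termN x i j n :
  theta_term (- x ^+ i) (- x ^+ j) n = zsign n * x ^+ (i * triz n + j * triz (n - 1)).
Proof.
rewrite /theta_term (exprNn (x ^+ i)) (exprNn (x ^+ j)) [X in _ = _ * X]exprD !exprM mulrACA -exprD.
congr (_ * _); by rewrite triz_square /zsign abszM -[LHS]signr_odd oddM andbb signr_odd.
Qed.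

Lemma theta_termP x i j n :
  theta_term (x ^+ i) (x ^+ j) n = x ^+ (i * triz n + j * triz (n - 1)).
Proof. by rewrite /theta_term exprD !exprM. Qed.

Definition srange (r : nat) : seq int := [seq i%:Z - r%:Z | i <- index_iota 0 (r + r).+1].

Lemma srangeS r : srange r.+1 = (- r.+1%:Z) :: rcons (srange r) r.+1%:Z.
Proof.
rewrite /srange /index_iota !subn0 addSn addnS.
have -> : iota 0 (r + r).+3 = 0%N :: rcons (iota 1 (r + r).+1) (r + r).+2.
  by rewrite -cats1 -[[:: _]]/(iota (1 + (r + r).+1) 1) -iotaD addn1.
rewrite map_cons map_rcons (iotaDl 1 0) -map_comp; congr (_ :: rcons _ _); try lia.
by apply: eq_map => i /=; lia.
Qed.

Lemma mem_srange r (j : int) : (j \in srange r) = (- r%:Z <= j <= r%:Z).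
Proof.
apply/mapP/idP => [[i]|jr]; first by rewrite mem_index_iota => ir ->; lia.
exists (absz (j + r%:Z)); [rewrite mem_index_iota|]; lia.
Qed.

Lemma tauE x r : tau x r =
  \sum_(j <- srange r) zsign j * x ^+ absz ((r * r)%N%:Z - j * j)%R.
Proof.
elim: r => [|r IH]; first by rewrite big_seq1 /zsign /= mulr1.
rewrite srangeS big_cons big_rcons /= IH /zsign abszN.
rewrite mulrNN -PoszM subrr absz0 expr0 absz_nat.
rewrite mulr_sumr [X in _ = _ + (X + _)](_ : _ = \sum_(j <- srange r)
   x ^+ (r + r).+1 * ((-1) ^+ absz j * x ^+ absz ((r * r)%N%:Z - j * j)%R)).
  by ring.
rewrite !big_seq; apply: eq_bigr => j; rewrite mem_srange => jr.
have jj : 0 <= (r * r)%N%:Z - j * j by nia.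
by rewrite mulrCA -exprD; congr (_ * x ^+ _); lia.
Qed.

(** The exponent 3r(r+1)/2 - j^2 + k^2 with k = l - j; it equals
    3r(r+1)/2 + l^2 - 2lj. *)
Definition hecke_exp (r : nat) (j l : int) : nat :=
  absz ((tri r + r + r * r)%N%:Z - j * j + (l - j) * (l - j))%R.

(** The contribution of l = k + j to theta times the Hecke sum, without its
    sign. *)
Definition hecke_slice x (l : int) : R :=
  \sum_(r < N) (-1) ^+ r * \sum_(j <- srange r) x ^+ hecke_exp r j l.

Lemma theta_hecke_slice x r j : x ^+ N = 0 -> (r < N)%N -> j \in srange r ->
  (\sum_(k <- zrange N) theta_term (- x) (- x) k) *
    (x ^+ (tri r + r) * (zsign j * x ^+ absz ((r * r)%N%:Z - j * j)%R)) =
  \sum_(l <- zrange (N + N)) zsign l * x ^+ hecke_exp r j l.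
Proof.
rewrite mem_srange => x0 rN jr; rewrite mulr_suml.
have r2 : 0 <= (r * r)%N%:Z - j * j by nia.
have sq (k : int) : 0 <= k * k by rewrite -expr2 sqr_ge0.
have expE l : hecke_exp r j l =
    (absz ((l - j) * (l - j))%R + (tri r + r + absz ((r * r)%N%:Z - j * j)%R))%N.
  by rewrite /hecke_exp; have := sq (l - j); lia.
have sqN (k : int) : (absz (k * k)%R < N)%N -> `|k| < N%:Z by rewrite abszM; nia.
have termE k : theta_term (- x) (- x) k *
    (x ^+ (tri r + r) * (zsign j * x ^+ absz ((r * r)%N%:Z - j * j)%R)) =
    zsign (k + j) * x ^+ hecke_exp r j (k + j).
  have := theta_termN x 1 1 k; rewrite expr1 => ->.
  by rewrite !mul1n triz_square expE addrK zsignD !exprD; ring.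
apply: (@big_support_bij _ _ _ _ _ _ _ [pred k | hecke_exp r j (k + j) < N]%N
  [pred l | hecke_exp r j l < N]%N _ _ (fun k => k + j) (fun l => l - j)).
- exact: zrange_uniq.
- exact: zrange_uniq.
- by move=> k /= kN; rewrite termE (expr_nil_ge x0) ?mulr0 // leqNgt.
- by move=> l /= lN; rewrite (expr_nil_ge x0) ?mulr0 // leqNgt.
- move=> k /= _ kN; split=> //.
  + by move: kN; rewrite expE addrK mem_zrange; have := sqN k; lia.
  + by rewrite addrK.
- move=> l /= _ lN; rewrite subrK; split => //.
  by move: lN; rewrite expE mem_zrange; have := sqN (l - j); lia.
Qed.

(** The sign (-1)^(j+k) becomes (-1)^l, so after the shift k = l - j only
    the exponent still depends on j. *)
Lemma theta_hecke x : x ^+ N = 0 ->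
  (\sum_(k <- zrange N) theta_term (- x) (- x) k) * hecke_sum N x =
  \sum_(l <- zrange (N + N)) zsign l * hecke_slice x l.
Proof.
move=> x0; transitivity (\sum_(r < N) (-1) ^+ r * \sum_(j <- srange r)
    \sum_(l <- zrange (N + N)) zsign l * x ^+ hecke_exp r j l).
  rewrite /hecke_sum mulr_sumr; apply: eq_bigr => r _.
  rewrite -mulrA mulrCA tauE; congr (_ * _); rewrite !mulr_sumr big_seq [RHS]big_seq.
  by apply: eq_bigr => j jr; rewrite -theta_hecke_slice ?ltn_ord.
rewrite /hecke_slice; under [RHS]eq_bigr do rewrite mulr_sumr.
rewrite [RHS]exchange_big; apply: eq_bigr => r _.
under [RHS]eq_bigr do rewrite mulrCA mulr_sumr.
by rewrite -mulr_sumr [in RHS]exchange_big.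
Qed.

(** At l = 0 the exponent does not depend on j, so the inner sum is 2r+1 equal
    terms and Jacobi's cube identity applies. *)
Lemma hecke_slice0 x : x ^+ N = 0 ->
  hecke_slice x 0 = qpoch (x ^+ 3) (x ^+ 3) N ^+ 3.
Proof.
move=> x0; rewrite -jacobi_cube ?nil_expS //; apply: eq_bigr => r _.
rewrite -mulrA; congr (_ * _).
have cE j : j \in srange r -> x ^+ hecke_exp r j 0 = x ^+ 3 ^+ tri r.
  move=> _; rewrite -exprM; congr (_ ^+ _); rewrite /hecke_exp sub0r mulrNN subrK.
  by have := tri_mul2 r; lia.
rewrite big_seq (eq_bigr (fun=> x ^+ 3 ^+ tri r)) -?big_seq; last by move=> j /cE.
by rewrite big_map big_mkord sumr_const card_ord mulr_natl.
Qed.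

(** Under l -> -l the exponent is invariant if j changes its sign too. *)
Lemma hecke_sliceN x l : hecke_slice x (- l) = hecke_slice x l.
Proof.
apply: eq_bigr => r _; congr (_ * _); rewrite !big_map big_nat_rev.
rewrite big_nat [RHS]big_nat; apply: eq_bigr => i ir.
congr (x ^+ absz _); have -> : (0 + (r + r).+1 - i.+1)%:Z = r%:Z + r%:Z - i%:Z by lia.
by ring.
Qed.

Lemma geometric_telescope x (e : nat -> nat) m d :
  (forall i, (i < m)%N -> e i = e i.+1 + d)%N ->
  (1 - x ^+ d) * (\sum_(i < m.+1) x ^+ e i) = x ^+ e m - x ^+ (e 0%N + d).
Proof.
elim: m => [|m IH] eP; first by rewrite big_ord1 exprD; ring.
rewrite big_ord_recr mulrDr /= IH => [|i im]; last by rewrite eP // ltnW.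
by rewrite eP // [x ^+ (e m.+1 + d)]exprD; ring.
Qed.

(** The two boundary terms of the geometric sum over |j| <= r are the terms of
    index r and -r-1 of one bilateral theta series. *)
Lemma hecke_slice_theta x (l : nat) : x ^+ N = 0 -> (0 < l)%N ->
  (1 - x ^+ (l + l)) * hecke_slice x l =
  \sum_(n <- zrange N) zsign n * x ^+ absz (3 * (triz n)%:Z + l%:Z * l%:Z - 2 * l%:Z * n)%R.
Proof.
move=> x0 l0; rewrite zsum_split mulr_sumr; apply: eq_bigr => r _.
rewrite mulrCA {2}/zsign /= exprS mulN1r mulNr -mulrBr; congr (_ * _).
rewrite big_map big_mkord (geometric_telescope x (m := r + r) (d := l + l)
  (e := fun i => hecke_exp r (i%:Z - r%:Z) l)); last first.
  move=> i ir; rewrite /hecke_exp; have sq (k : int) : 0 <= k * k by rewrite -expr2 sqr_ge0.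
  have : 0 <= (r * r)%N%:Z - (i%:Z - r%:Z) * (i%:Z - r%:Z) by nia.
  have : 0 <= (r * r)%N%:Z - (i.+1%:Z - r%:Z) * (i.+1%:Z - r%:Z) by nia.
  have := sq (l%:Z - (i%:Z - r%:Z)); have := sq (l%:Z - (i.+1%:Z - r%:Z)).
  nia.
have := tri_mul2 r => t2.
congr (x ^+ _ - x ^+ _); rewrite /hecke_exp; nia.
Qed.

Lemma qpoch_add (a q : R) m n : qpoch a q (m + n) = qpoch a q m * qpoch (a * q ^+ m) q n.
Proof.
rewrite /qpoch big_split_ord; congr (_ * _).
by apply: eq_bigr => i _; rewrite /= exprD mulrA.
Qed.

Lemma qpoch_dissect (a q : R) m n :
  qpoch a q (n * m) = \prod_(i < m) qpoch (a * q ^+ i) (q ^+ m) n.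
Proof.
elim: n => [|n IH]; first by rewrite mul0n /qpoch big_ord0 big1 // => i _; rewrite big_ord0.
rewrite mulSnr qpoch_add IH {2}/qpoch -big_split; apply: eq_bigr => i _ /=.
by rewrite qpochS -exprM mulnC mulrAC.
Qed.

Lemma qpoch_dissect_inf (a q : R) m : q ^+ N = 0 -> (0 < m)%N ->
  qpoch a q N = \prod_(i < m) qpoch (a * q ^+ i) (q ^+ m) N.
Proof. by move=> q0 m0; rewrite -qpoch_dissect (qpoch_stable a q0) ?leq_pmulr. Qed.

(** This is the theta function f(-q,-q^2); its product collects the residues
    1, 2 and 0 modulo 3. *)
Lemma euler_pentagonal x : x ^+ N = 0 ->
  \sum_(n <- zrange N) zsign n * x ^+ (triz n + 2 * triz (n - 1)) = qpoch x x N.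
Proof.
move=> x0; rewrite (qpoch_dissect_inf x x0 (isT : 0 < 3)%N) !big_ord_recr big_ord0 /=.
have := triple_product (nil_opp x0) (nil_opp (nil_expS 1 x0)).
rewrite !opprK mulrNN -!exprS => e.
rewrite mul1r expr1 e; apply: eq_bigr => n _.
by have := theta_termN x 1 2 n; rewrite expr1 mul1n.
Qed.

Lemma sum_monomial_bij x (r s : seq int) (c d : int -> R) (e f : int -> nat) (h k : int -> int) :
  x ^+ N = 0 -> uniq r -> uniq s -> cancel h k -> cancel k h ->
  (forall n, e n < N -> n \in r)%N -> (forall n, f n < N -> n \in s)%N ->
  (forall n, c n = d (h n)) -> (forall n, e n = f (h n)) ->
  \sum_(n <- r) c n * x ^+ e n = \sum_(n <- s) d n * x ^+ f n.
Proof.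
move=> x0 ur us hK kK re sf cd ef.
apply: (@big_support_bij _ _ _ _ _ _ _ [pred n | e n < N]%N [pred n | f n < N]%N _ _ h k) => //.
- by move=> n /= nN; rewrite (expr_nil_ge x0) ?mulr0 // leqNgt.
- by move=> n /= nN; rewrite (expr_nil_ge x0) ?mulr0 // leqNgt.
- by move=> n /= _ nN; rewrite hK cd ef; split; rewrite -?ef ?sf // -ef.
- by move=> n /= _ nN; rewrite kK; split; rewrite ?re // ef kK.
Qed.

Definition legendre3 (l : nat) : R :=
  match (l %% 3)%N with 0 => 0 | 1 => 1 | _ => -1 end.

(** Completing the square, with l = 3m, 3m+1 or 3m+2, shifts or reflects the
    series to Euler's pentagonal number series, or, when 3 divides l, to a
    series in which the terms n and -1-n cancel. *)
Lemma shifted_theta x (l : nat) : x ^+ N = 0 -> (0 < l)%N ->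
  \sum_(n <- zrange N) zsign n * x ^+ absz (3 * (triz n)%:Z + l%:Z * l%:Z - 2 * l%:Z * n)%R
  = legendre3 l * x ^+ ((l * l + 3 * l).-1 %/ 3) * qpoch x x N.
Proof.
move=> x0 l0.
have sq (k : int) : 0 <= k * k by rewrite -expr2 sqr_ge0.
pose e n := absz (3 * (triz n)%:Z + l%:Z * l%:Z - 2 * l%:Z * n)%R.
have eE n : (e n)%:Z * 2 = 2 * ((l%:Z - n) * (l%:Z - n)) + n * n + 3 * n.
  have := triz_mul2 n; have := sq (l%:Z - n); rewrite /e.
  have [n0|n0] := lerP 0 n; first by lia.
  have : 0 <= (l%:Z - n - 1) * (l%:Z - n + 1) by apply: mulr_ge0; lia.
  have : 0 <= (n + 1) * (n + 2).
    by have [?|?] := lerP (-1) n; [|rewrite -mulrNN]; apply: mulr_ge0; lia.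
  by lia.
have er n : (e n < N)%N -> n \in zrange N.
  rewrite mem_zrange; have := eE n; have := sq n; have [n0|n0] := lerP 0 n.
    by have := sq (l%:Z - n); lia.
  have : 0 <= (l%:Z - 1) * (l%:Z + 1 - n - n) by apply: mulr_ge0; lia.
  by have := triz_mul2 n; lia.
have [m [lE|lE|lE]] : exists m, [\/ l = (3 * m)%N, l = (3 * m + 1)%N | l = (3 * m + 2)%N].
  exists (l %/ 3)%N; have := divn_eq l 3; have := ltn_pmod l (isT : 0 < 3)%N.
  case: (l %% 3)%N => [|[|[|?]]] // _ E.
  - by constructor 1; lia.
  - by constructor 2; lia.
  - by constructor 3; lia.
- rewrite (_ : legendre3 l = 0) ?mul0r; last by rewrite /legendre3 lE mulnC modnMl.
  pose f (n : int) := (3 * triz n + 3 * (m * m + m))%N.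
  rewrite (sum_monomial_bij (s := zrange N) (d := zsign) (e := e) (f := f)
    (h := fun n => n - (2 * m)%N%:Z) (k := fun n => n + (2 * m)%N%:Z) x0); rewrite ?zrange_uniq //.
  + rewrite zsum_split big1 // => k _.
    by rewrite /f /zsign /= exprS mulN1r mulNr subrr.
  + exact: subrK.
  + exact: addrK.
  + by move=> n nN; apply: triz_range; apply: leq_ltn_trans nN; rewrite /f; nia.
  + by move=> n; rewrite zsignD /zsign abszN absz_nat -[X in _ = _ * X]signr_odd oddM mulr1.
  + move=> n; have := triz_mul2 n; have := triz_mul2 (n - (2 * m)%N%:Z).
    rewrite /f; have := eE n; lia.
(* l = 3m + 1: the shift n -> n - 2m *)
- have lE3 : ((l * l + 3 * l).-1 = (3 * (m * m) + 5 * m + 1) * 3)%N by nia.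
  rewrite lE3 mulnK // (_ : legendre3 l = 1) ?mul1r; last first.
    by rewrite /legendre3 lE mulnC modnMDl.
  rewrite -(euler_pentagonal x0) mulr_sumr.
  pose f (n : int) := (3 * (m * m) + 5 * m + 1 + (triz n + 2 * triz (n - 1)))%N.
  under [RHS]eq_bigr do rewrite mulrCA -exprD.
  apply: (sum_monomial_bij (e := e) (f := f)
    (h := fun n => n - (2 * m)%N%:Z) (k := fun n => n + (2 * m)%N%:Z) x0); rewrite ?zrange_uniq //.
  + exact: subrK.
  + exact: addrK.
  + by move=> n nN; apply: triz_range; apply: leq_ltn_trans nN; rewrite /f; nia.
  + by move=> n; rewrite zsignD /zsign abszN absz_nat -[X in _ = _ * X]signr_odd oddM mulr1.
  + move=> n; have := triz_mul2 (n - (2 * m)%N%:Z); have := triz_pred (n - (2 * m)%N%:Z).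
    rewrite /f; have := eE n; lia.
(* l = 3m + 2: the reflection n -> 2m + 1 - n, which changes the sign *)
- have lE3 : ((l * l + 3 * l).-1 = (3 * (m * m) + 7 * m + 3) * 3)%N by nia.
  rewrite lE3 mulnK // (_ : legendre3 l = -1) ?mulN1r ?mulNr; last first.
    by rewrite /legendre3 lE mulnC modnMDl.
  rewrite -(euler_pentagonal x0) mulr_sumr -sumrN.
  pose f (n : int) := (3 * (m * m) + 7 * m + 3 + (triz n + 2 * triz (n - 1)))%N.
  under [RHS]eq_bigr do rewrite mulrCA -exprD -mulNr.
  apply: (sum_monomial_bij (e := e) (f := f) (d := fun n => - zsign n)
    (h := fun n => (2 * m + 1)%N%:Z - n) (k := fun n => (2 * m + 1)%N%:Z - n) x0); rewrite ?zrange_uniq //.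
  + exact: subKr.
  + exact: subKr.
  + by move=> n nN; apply: triz_range; apply: leq_ltn_trans nN; rewrite /f; nia.
  + move=> n; rewrite zsignD /zsign abszN absz_nat -[(-1) ^+ (_ + _)]signr_odd oddD oddM.
    by rewrite mulN1r opprK.
  + move=> n; have := triz_mul2 ((2 * m + 1)%N%:Z - n); have := triz_pred ((2 * m + 1)%N%:Z - n).
    rewrite /f; have := eE n; lia.
Qed.

End HeckeTheta.

(** * The even part of lambda *)

Section EvenPart.
Variables (R : comNzRingType) (N : nat).
Implicit Types x y : R.
Local Notation zsign := (zsign R).
Local Notation legendre3 := (legendre3 R).
Local Notation qinf a q := (qpoch a q N).

Definition lambert_term x (l : nat) : R :=
  legendre3 l * x ^+ ((l * l + 3 * l).-1 %/ 3) * geom N (x ^+ (l + l)).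

Definition lambert x : R :=
  \sum_(l <- zrange (N + N) | l != 0) zsign l * lambert_term x (absz l).

Lemma hecke_sliceE x (l : int) : x ^+ N = 0 -> l != 0 ->
  hecke_slice N x l = qinf x x * lambert_term x (absz l).
Proof.
move=> x0 l0; have -> : hecke_slice N x l = hecke_slice N x (absz l)%:Z.
  by case: l l0 => // k _; rewrite NegzE hecke_sliceN.
have k0 : (0 < absz l)%N by rewrite absz_gt0.
have := hecke_slice_theta x0 k0; rewrite shifted_theta // /lambert_term => e.
have [k kE] : exists k, (absz l + absz l = k.+1)%N by exists (absz l + absz l).-1; lia.
have x1 : (x ^+ (absz l + absz l)) ^+ N = 0 by rewrite kE nil_expS.
apply: (one_sub_reg x1); rewrite e mulrCA [X in _ = _ * X]mulrCA geomP // mulr1 mulrC //.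
Qed.

(** For l = 3m+1 and l = 3m+2 the exponent (l^2+3l-1)/3 is 3m^2+5m+1 and
    3m^2+7m+3, an odd number in both cases. *)
Lemma lambertN x : lambert (- x) = - lambert x.
Proof.
rewrite /lambert -sumrN; apply: eq_bigr => l l0; rewrite -mulrN; congr (_ * _).
rewrite /lambert_term; have k0 : (0 < absz l)%N by rewrite absz_gt0.
move: (absz l) k0 => {l l0} l l0.
rewrite [(- x) ^+ (l + l)]exprNn -signr_odd addnn odd_double expr0 mul1r.
rewrite -mulNr; congr (_ * _); rewrite exprNn -signr_odd.
have := divn_eq l 3; have := ltn_pmod l (isT : 0 < 3)%N; rewrite /legendre3.
set m := (l %/ 3)%N; case: (l %% 3)%N => [|[|[|?]]] // _ lE.
- by rewrite !mul0r oppr0.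
- have -> : ((l * l + 3 * l).-1 %/ 3 = 3 * (m * m) + 5 * m + 1)%N.
    by rewrite (_ : (l * l + 3 * l).-1 = (3 * (m * m) + 5 * m + 1) * 3)%N ?mulnK //; nia.
  rewrite !oddD !oddM; case: (odd m); rewrite /= !mulN1r ?mul1r ?mulNr //.
- have -> : ((l * l + 3 * l).-1 %/ 3 = 3 * (m * m) + 7 * m + 3)%N.
    by rewrite (_ : (l * l + 3 * l).-1 = (3 * (m * m) + 7 * m + 3) * 3)%N ?mulnK //; nia.
  by rewrite !oddD !oddM; case: (odd m); rewrite /= ?mulN1r ?mulNr ?mulN1r.
Qed.

Lemma qpoch_split2 x : x ^+ N = 0 -> qinf x x = qinf x (x ^+ 2) * qinf (x ^+ 2) (x ^+ 2).
Proof.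
move=> x0; rewrite (qpoch_dissect_inf x x0 (isT : 0 < 2)%N) !big_ord_recr big_ord0 /=.
by rewrite mul1r mulr1.
Qed.

(** The theta series by which the Hecke sum is multiplied is f(-q,-q), that is
    (q;q^2)^2 (q^2;q^2). *)
Lemma lambda_lambert x : x ^+ N = 0 ->
  qinf x x * (qinf (x ^+ 2) (x ^+ 2) * lambda_sum N x) =
  qinf (x ^+ 3) (x ^+ 3) ^+ 3 + qinf x x * lambert x.
Proof.
move=> x0; have N0 := nilpotent_order_gt0 x0.
transitivity ((\sum_(k <- zrange N) theta_term (- x) (- x) k) * hecke_sum N x).
  rewrite -(triple_product (nil_opp x0) (nil_opp x0)) !opprK mulrNN -expr2.
  rewrite lambda_sum_hecke // qpoch_split2 //; ring.
rewrite theta_hecke // (bigD1_seq 0) ?zrange_uniq //=; last by rewrite mem_zrange; lia.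
rewrite hecke_slice0 // /zsign /= mul1r mulr_sumr; congr (_ + _).
by apply: eq_bigr => l l0; rewrite hecke_sliceE // mulrCA.
Qed.

(** The product of 1 - x^k over all k = 1, 5 mod 6. *)
Definition odd_coprime3 x : R := qinf x (x ^+ 6) * qinf (x ^+ 5) (x ^+ 6).

Lemma qpoch_odd_split3 x : x ^+ N = 0 ->
  qinf x (x ^+ 2) = qinf (x ^+ 3) (x ^+ 6) * odd_coprime3 x.
Proof.
move=> x0; rewrite (qpoch_dissect_inf x (nil_expS 1 x0) (isT : 0 < 3)%N) !big_ord_recr big_ord0 /=.
rewrite mul1r mulr1 -!exprM -!exprS /odd_coprime3; ring.
Qed.

(** Here the exponents are 3n^2+2n+3m^2 on the left and 6a^2-2a+6b^2-2b on the
    right. The signs on the left add up to (-1)^m + (-1)^n, so exactly the pairs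
    with n + m even survive, and these are n = -(a+b), m = a-b. *)
Lemma theta_product_sum x : x ^+ N = 0 ->
  (\sum_(n <- zrange N) theta_term (x ^+ 5) (x ^+ 1) n) *
    (\sum_(m <- zrange N) theta_term (- x ^+ 3) (- x ^+ 3) m) +
  (\sum_(n <- zrange N) theta_term (- x ^+ 5) (- x ^+ 1) n) *
    (\sum_(m <- zrange N) theta_term (x ^+ 3) (x ^+ 3) m) =
  2 * (\sum_(n <- zrange N) theta_term (- x ^+ 4) (- x ^+ 8) n) ^+ 2.
Proof.
move=> x0.
have sq (n : int) : 0 <= n * n by rewrite -expr2 sqr_ge0.
pose e (p : int * int) := absz (3 * (p.1 * p.1) + 2 * p.1 + 3 * (p.2 * p.2))%R.
pose f (p : int * int) := absz (6 * (p.1 * p.1) - 2 * p.1 + 6 * (p.2 * p.2) - 2 * p.2)%R.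
have expE (n m : int) : (5 * triz n + 1 * triz (n - 1) + (3 * triz m + 3 * triz (m - 1)) = e (n, m))%N.
  rewrite /e /=; have := triz_mul2 n; have := triz_mul2 m; have := triz_pred n; have := triz_pred m.
  lia.
have expF (n m : int) : (4 * triz n + 8 * triz (n - 1) + (4 * triz m + 8 * triz (m - 1)) = f (n, m))%N.
  rewrite /f /=; have := triz_mul2 n; have := triz_mul2 m; have := triz_pred n; have := triz_pred m.
  lia.
pose Z2 := [seq (n, m) | n <- zrange N, m <- zrange N].
have Z2_uniq : uniq Z2 by rewrite allpairs_uniq ?zrange_uniq // => -[? ?] [? ?].
have Z2P n m : ((n, m) \in Z2) = (n \in zrange N) && (m \in zrange N).
  by rewrite /Z2; apply/allpairsP/andP => [[[? ?] [? ? [-> ->]]]|[? ?]] //; exists (n, m).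
have bound (n : int) : n <= n * n /\ - n <= n * n.
  by have := sq n; have := triz_mul2 n; have := triz_mul2 (n - 1); split; lia.
have e_range (p : int * int) : (e p < N)%N -> p \in Z2.
  case: p => n m; rewrite Z2P !mem_zrange /e /=.
  by have [? ?] := bound n; have [? ?] := bound m; lia.
have f_range (p : int * int) : (f p < N)%N -> p \in Z2.
  case: p => n m; rewrite Z2P !mem_zrange /f /=.
  by have [? ?] := bound n; have [? ?] := bound m; lia.
transitivity (\sum_(p <- Z2) (zsign p.1 + zsign p.2) * x ^+ e p).
  rewrite !big_distrlr /= -big_split big_allpairs /=; apply: eq_bigr => n _.
  rewrite -big_split; apply: eq_bigr => m _ /=.
  by rewrite !theta_termN !theta_termP -expE !exprD; ring.
transitivity (\sum_(p <- Z2) 2 * zsign (p.1 + p.2) * x ^+ f p); last first.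
  rewrite expr2 big_distrlr /= mulr_sumr big_allpairs; apply: eq_bigr => n _ /=.
  rewrite mulr_sumr; apply: eq_bigr => m _.
  by rewrite !theta_termN -expF zsignD !exprD; ring.
have parity (n m : int) : odd (absz (m - n)) -> zsign n + zsign m = 0.
  by move=> on; rewrite -(subrK n m) zsignD {2}/zsign -signr_odd on; ring.
pose h (p : int * int) : int * int := (divz (p.2 - p.1) 2, - divz (p.2 + p.1) 2).
pose k (p : int * int) : int * int := (- (p.1 + p.2), p.1 - p.2).
have fk p : f p = e (k p) by case: p => a b; rewrite /f /e /=; congr absz; ring.
have zsignN n : zsign (- n) = zsign n by rewrite /zsign abszN.
apply: (@big_support_bij _ _ _ (int * int)%type (int * int)%type Z2 Z2
  [pred p | ~~ odd (absz (p.2 - p.1)) && (e p < N)%N] [pred p | f p < N]%N _ _ h k) => //.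
- move=> [n m] /=; rewrite negb_and negbK => /orP[/parity->|eN]; first by rewrite mul0r.
  by rewrite (expr_nil_ge x0) ?mulr0 // leqNgt.
- by move=> p /= fN; rewrite (expr_nil_ge x0) ?mulr0 // leqNgt.
- move=> [n m] _ /andP[nm eN]; rewrite /= in nm.
  have [a [b [nE mE]]] : exists a b, n = - (a + b) /\ m = a - b.
    by exists (divz (m - n) 2), (- divz (m + n) 2); split; lia.
  have hE : h (n, m) = (a, b) by congr (_, _); rewrite /= nE mE; lia.
  have kE : k (a, b) = (n, m) by rewrite /k /= nE mE.
  rewrite hE; split=> //; rewrite /= ?fk ?kE //; first by apply: f_range; rewrite fk kE.
  by rewrite nE mE zsignN [zsign (a - b)]zsignD zsignN zsignD; ring.
- move=> [a b] _ /= fN; split.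
  + by rewrite -fk fN andbT; lia.
  + by apply: e_range; rewrite -fk.
  + by congr (_, _); rewrite /=; lia.
Qed.

Lemma nil_exp x k : x ^+ N = 0 -> (0 < k)%N -> (x ^+ k) ^+ N = 0.
Proof. by case: k => // k x0 _; apply: nil_expS. Qed.

Lemma theta_product_eval x : x ^+ N = 0 ->
  qinf (x ^+ 6) (x ^+ 6) ^+ 2 *
    (odd_coprime3 (- x) * qinf (x ^+ 3) (x ^+ 6) ^+ 2 +
     odd_coprime3 x * qinf (- x ^+ 3) (x ^+ 6) ^+ 2) =
  2 * qinf (x ^+ 4) (x ^+ 4) ^+ 2.
Proof.
move=> x0; have nX k : (0 < k)%N -> (x ^+ k) ^+ N = 0 by exact: nil_exp.
have := theta_product_sum x0; rewrite -!triple_product ?nil_opp ?nX //.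
rewrite !mulrNN -!exprD !opprK !expr1 => e.
rewrite -[(5 + 1)%N]/6%N -[(3 + 3)%N]/6%N -[(4 + 8)%N]/12%N in e.
have -> : qinf (x ^+ 4) (x ^+ 4) =
    qinf (x ^+ 4) (x ^+ 12) * qinf (x ^+ 8) (x ^+ 12) * qinf (x ^+ 12) (x ^+ 12).
  rewrite (qpoch_dissect_inf (x ^+ 4) (nX 4 isT) (isT : 0 < 3)%N).
  by rewrite !big_ord_recr big_ord0 /= mul1r -!exprM -!exprD.
have e6 : (- x) ^+ 6 = x ^+ 6 by ring.
have e5 : (- x) ^+ 5 = - x ^+ 5 by ring.
by rewrite -e /odd_coprime3 e6 e5; ring.
Qed.

(** Both terms are multiples of (x^3;x^6) (-x^3;x^6) (x^6;x^6)^3, which is even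
    in x, and their cofactors are the two terms of theta_product_eval. *)
Lemma cubes_product x : x ^+ N = 0 ->
  qinf (- x) (x ^+ 2) * qinf (x ^+ 3) (x ^+ 3) ^+ 3 +
  qinf x (x ^+ 2) * qinf ((- x) ^+ 3) ((- x) ^+ 3) ^+ 3 =
  2 * qinf (x ^+ 6) (x ^+ 12) * qinf (x ^+ 6) (x ^+ 6) * qinf (x ^+ 4) (x ^+ 4) ^+ 2.
Proof.
move=> x0; have nX k : (0 < k)%N -> (x ^+ k) ^+ N = 0 by exact: nil_exp.
have e2 : (- x) ^+ 2 = x ^+ 2 by ring.
have e3 : (- x) ^+ 3 = - x ^+ 3 by ring.
have e6 : (- x) ^+ 6 = x ^+ 6 by ring.
have e32 : (- x ^+ 3) ^+ 2 = x ^+ 6 by ring.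
have e33 : (x ^+ 3) ^+ 2 = x ^+ 6 by ring.
have e23 : (x ^+ 2) ^+ 3 = x ^+ 6 by ring.
have := qpoch_odd_split3 (nil_opp x0); rewrite e2 e3 e6 => ->.
rewrite (qpoch_split2 (nX 3 isT)) (qpoch_odd_split3 x0).
rewrite (qpoch_split2 (nil_opp (nX 3 isT))) e32 e33.
have -> : qinf (x ^+ 6) (x ^+ 12) = qinf (x ^+ 3) (x ^+ 6) * qinf (- x ^+ 3) (x ^+ 6).
  rewrite /qpoch -big_split; apply: eq_bigr => k _ /=.
  by rewrite -[12%N]/(6 * 2)%N exprM [x ^+ 6 ^+ 2 ^+ k]exprAC -e33; ring.
rewrite [RHS](_ : _ = qinf (x ^+ 3) (x ^+ 6) * qinf (- x ^+ 3) (x ^+ 6) *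
  qinf (x ^+ 6) (x ^+ 6) * (2 * qinf (x ^+ 4) (x ^+ 4) ^+ 2)); last by ring.
by rewrite -theta_product_eval //; ring.
Qed.

(** Multiply lambda_lambert at x by (-x;x^2) and at -x by (x;x^2), and add: the
    Lambert series cancel. *)
Lemma even_part x : x ^+ N = 0 ->
  qinf (x ^+ 6) (x ^+ 12) * odd_coprime3 (x ^+ 2) ^+ 3 *
    (lambda_sum N x + lambda_sum N (- x)) = 2 * qinf (x ^+ 12) (x ^+ 12).
Proof.
move=> x0; have nX k : (0 < k)%N -> (x ^+ k) ^+ N = 0 by exact: nil_exp.
have e2 : (- x) ^+ 2 = x ^+ 2 by ring.
have e4 : (x ^+ 2) ^+ 2 = x ^+ 4 by ring.
have e6 : (x ^+ 2) ^+ 3 = x ^+ 6 by ring.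
have e12 : (x ^+ 6) ^+ 2 = x ^+ 12 by ring.
have e26 : (x ^+ 2) ^+ 6 = x ^+ 12 by ring.
have lamP := lambda_lambert x0; have lamN := lambda_lambert (nil_opp x0).
rewrite lambertN e2 (qpoch_split2 (nil_opp x0)) e2 in lamN.
rewrite (qpoch_split2 x0) in lamP.
have cubes := cubes_product x0.
have oo : qinf x (x ^+ 2) * qinf (- x) (x ^+ 2) = qinf (x ^+ 2) (x ^+ 4).
  rewrite /qpoch -big_split; apply: eq_bigr => k _ /=.
  by rewrite -e4 [x ^+ 2 ^+ 2 ^+ k]exprAC; ring.
have pe2 := qpoch_split2 (nX 2 isT); rewrite e4 in pe2.
have pe6 := qpoch_split2 (nX 6 isT); rewrite e12 in pe6.
have o2 := qpoch_odd_split3 (nX 2 isT); rewrite e4 e6 e26 in o2.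
apply: (@qpoch_reg _ N (x ^+ 6) (x ^+ 12) N _ _ (nX 6 isT)).
apply: (@qpoch_reg _ N (x ^+ 6) (x ^+ 12) N _ _ (nX 6 isT)).
apply: (@qpoch_reg _ N (x ^+ 4) (x ^+ 4) N _ _ (nX 4 isT)).
apply: (@qpoch_reg _ N (x ^+ 4) (x ^+ 4) N _ _ (nX 4 isT)).
move: lamP lamN cubes oo pe2 pe6 o2.
move: (qinf x _) (qinf (- x) _) (qinf (x ^+ 2) (x ^+ 2)) (qinf (x ^+ 2) (x ^+ 4))
  (qinf (x ^+ 4) _) (qinf (x ^+ 6) (x ^+ 6)) (qinf (x ^+ 6) (x ^+ 12)) (qinf (x ^+ 12) _)
  (qinf (x ^+ 3) _) (qinf ((- x) ^+ 3) _) (odd_coprime3 _) (lambda_sum _ x) (lambda_sum _ (- x)) (lambert x).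
move=> o o' p2 y2 p4 p6 y6 p12 c c' r L L' La lamP lamN cubes oo pe2 pe6 o2.
transitivity (o * o' * p2 ^+ 2 * (L + L')).
  by rewrite oo pe2 o2; ring.
transitivity (o' * (o * p2 * (p2 * L)) + o * (o' * p2 * (p2 * L'))); first by ring.
rewrite lamP lamN; transitivity (o' * c ^+ 3 + o * c' ^+ 3); first by ring.
by rewrite cubes pe6; ring.
Qed.

End EvenPart.

(** * Evaluation of integer polynomials *)

Section Evaluation.
Variables (R : comNzRingType) (N : nat).

Lemma rmorph_poly_trunc (f : {rmorphism {poly int} -> R}) p : f 'X ^+ N = 0 ->
  f p = \sum_(m < N) (p`_m)%:~R * f 'X ^+ m.
Proof.
move=> x0; have {1}-> : p = \poly_(i < N + size p) p`_i.
  apply/polyP => i; rewrite coef_poly; case: ltnP => // ip.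
  by rewrite nth_default // (leq_trans (leq_addl _ _) ip).
rewrite poly_def rmorph_sum -(big_mkord xpredT (fun i => f (p`_i *: 'X^i))) /=.
rewrite (@big_cat_nat _ _ _ N) //= ?leq_addr // [X in _ + X]big_nat_cond [X in _ + X]big1 ?addr0.
  rewrite big_mkord; apply: eq_bigr => i _.
  by rewrite -[p`_i in LHS]intz scaler_int rmorphMz rmorphXn mulrzl.
move=> i /andP[/andP[Ni _] _].
by rewrite -[p`_i in LHS]intz scaler_int rmorphMz rmorphXn (expr_nil_ge x0) // mul0rz.
Qed.

Lemma rmorph_qpoch (S : comNzRingType) (f : {rmorphism S -> R}) a q n :
  f (qpoch a q n) = qpoch (f a) (f q) n.
Proof.
rewrite /qpoch rmorph_prod; apply: eq_bigr => i _.
by rewrite rmorphB rmorph1 rmorphM rmorphXn.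
Qed.

(** Modulo x^N both inner sums of the definition of the coefficients may be
    extended to a common length N, and then they are an evaluation at x. *)
Lemma lambda_sum_coef (x : R) : x ^+ N = 0 ->
  lambda_sum N x = \sum_(m < N) (P_lambda m)%:~R * x ^+ m.
Proof.
move=> x0; pose f : {rmorphism {poly int} -> R} := horner_morph (commr_int x).
have fX : f 'X = x by rewrite /f /= horner_morphX.
pose d n := qpoch (- 'X) 'X n : {poly int}.
pose p n := (-1) ^+ n * 'X^n * qpoch 'X ('X^2) n : {poly int}.
have fd n : f (d n) = qpoch (- x) x n by rewrite rmorph_qpoch rmorphN fX.
have fp n : f (p n) = (- x) ^+ n * qpoch x (x ^+ 2) n.
  rewrite /p rmorphM rmorphM rmorph_qpoch.
  by rewrite (rmorphXn f n (-1)) (rmorphXn f n 'X) (rmorphXn f 2 'X) rmorphN1 fX [in RHS]exprNn.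
have trunc (u v : {poly int}) k : v`_0 = 1 -> (k < N)%N ->
    (\sum_(j < N) u * (1 - v) ^+ j)`_k = fps_div u v k.
  by case: N => // M v0 kM; rewrite fps_div_trunc.
transitivity (f (\sum_(n < N) \sum_(j < N) p n * (1 - d n) ^+ j)).
  rewrite rmorph_sum; apply: eq_bigr => n _.
  rewrite rmorph_sum /geom mulr_sumr; apply: eq_bigr => j _.
  by rewrite rmorphM rmorphXn rmorphB rmorph1 fd fp.
rewrite rmorph_poly_trunc fX //; apply: eq_bigr => m _; congr (_ %:~R * _).
rewrite coef_sum -(P_lambda_sum (ltn_ord m)); apply: eq_bigr => n _.
by rewrite trunc ?ltn_ord // lambda_term_den.
Qed.

End Evaluation.

Lemma qpoly_coef_eq0 N (p : {poly int}) i : (i < N)%N ->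
  in_qpoly 'X^N p = 0 -> p`_i = 0.
Proof.
move=> iN e; have := @Pdiv.RingMonic.rdivp_eq _ _ (@monic_mk_monic _ ('X^N : {poly int})) p.
have -> : Pdiv.Ring.rmodp p (mk_monic 'X^N) = 0 by have := congr1 val e.
rewrite addr0 mk_monic_Xn => ->; rewrite coefMXn.
by case: N iN {e} => // N iN; rewrite /= iN.
Qed.

Lemma in_qpolyX_nil N : (0 < N)%N -> in_qpoly ('X^N : {poly int}) 'X ^+ N = 0.
Proof.
move=> N0; rewrite -rmorphXn; apply/val_inj => /=.
have mkE : mk_monic ('X^N : {poly int}) = 'X^N by rewrite mk_monic_Xn; case: N N0.
by rewrite mkE Pdiv.RingMonic.rmodpp ?monicXn.
Qed.

(** * The generating function of the coloured partitions *)

Section GeneratingFunction.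
Variable n : nat.
Local Notation K := ('I_n.+1 * 'I_3)%type.

(** The signed weight of having v parts of size k and colour c; it is 0 when
    this is not allowed. *)
Definition part_weight (k c v : nat) : int :=
  if v == 0%N then 1
  else if (0 < k)%N && (c < ncolours k)%N then
    if (k %% 6 == 0)%N then - (v == 1%N)%:R else 1
  else 0.

Definition part_gf : {poly int} := \prod_(k < n.+1) \prod_(c < 3)
  \sum_(v < n.+1) (part_weight k c v)%:P * 'X^(k * v).

Lemma part_weight_prod (m : multiplicities n) :
  \prod_(i : K) part_weight i.1 i.2 (m i) =
  if [forall k : 'I_n.+1, forall c : 'I_3,
     (0 < m (k, c))%N ==> (0 < k)%N && (c < ncolours k)%N] && distinct_mod6_0 m
  then (-1) ^+ nparts_mod6_0 m else 0.
Proof.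
case: ifPn => [/andP[/forallP colP /forallP dP]|].
  transitivity (\prod_(k < n.+1) \prod_(c < 3) (if (k %% 6 == 0)%N then (-1) ^+ m (k, c) else 1 : int)).
    rewrite pair_bigA; apply: eq_bigr => -[k c] _ /=; rewrite /part_weight.
    have /forallP/(_ c) := colP k; have /forallP/(_ c) := dP k; rewrite mod0n.
    case: (nat_of_ord (m (k, c))) => [|v] /=; first by rewrite expr0 if_same.
    by move=> dv ->; case: ifP dv => //= _; case: v; rewrite ?expr1.
  rewrite /nparts_mod6_0.
  rewrite -prodrXr [RHS]big_mkcond; apply: eq_bigr => k _.
  by rewrite mod0n; case: ifP => _; [rewrite prodrXr | rewrite big1].
move=> bad.
have [i wi] : exists i : K, part_weight i.1 i.2 (m i) = 0; last first.
  by rewrite (bigD1 i) //= wi mul0r.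
move: bad; rewrite negb_and => /orP[/forallPn[k]|/forallPn[k]] /forallPn[c];
  rewrite negb_imply => /andP[H1 H2]; exists (k, c); rewrite /part_weight /=.
  by rewrite -leqn0 leqNgt H1 /= (negbTE H2).
move: H1 H2; rewrite mod0n -ltnNge => -> m2.
by rewrite !gtn_eqF ?oppr0 ?if_same // (ltn_trans _ m2).
Qed.

(** Expanding the product over all coloured sizes gives one term for each choice
    of multiplicities. *)
Lemma part_gf_coef : part_gf`_n = (P_lambda_de n)%:Z - (P_lambda_do n)%:Z.
Proof.
rewrite /part_gf pair_bigA (bigA_distr_bigA (fun (i : K) (v : 'I_n.+1) =>
  (part_weight i.1 i.2 v)%:P * 'X^(i.1 * v))) coef_sum.
pose A (m : multiplicities n) := is_colour_partition m && distinct_mod6_0 m.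
transitivity (\sum_(m : multiplicities n | A m) (-1) ^+ nparts_mod6_0 m : int).
  rewrite [RHS]big_mkcond; apply: eq_bigr => m _.
  rewrite big_split /= -rmorph_prod part_weight_prod prodrXr coefCM coefXn.
  rewrite /A /is_colour_partition [(\sum_(k < n.+1) _ == n)%N]eq_sym pair_bigA /=.
  have -> : (\sum_(i : K) i.1 * m (i.1, i.2) = \sum_(i : K) i.1 * m i)%N by apply: eq_bigr => -[].
  by case: (n == _); rewrite ?andbT ?andbF ?mulr1 ?mulr0.
rewrite (bigID (fun m => odd (nparts_mod6_0 m))) /= addrC.
congr (_ + _).
  rewrite (eq_bigr (fun=> 1)) => [|m /andP[_ /negbTE om]]; last by rewrite -signr_odd om.
  rewrite sumr_const natz /P_lambda_de cardsE; congr Posz; apply: eq_card => m.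
  by rewrite unfold_in /= /A -andbA.
rewrite (eq_bigr (fun=> -1)) => [|m /andP[_ om]]; last by rewrite -signr_odd om.
rewrite sumr_const mulNrn natz /P_lambda_do cardsE; congr (- Posz _); apply: eq_card => m.
by rewrite unfold_in /= /A -andbA.
Qed.

Variables (R : comNzRingType) (y : R).
Hypothesis y0 : y ^+ n.+1 = 0.

(** Factors of index above n are 1, so the product may be indexed by the sizes
    k <= n of its factors 1 - y^k. *)
Lemma qpoch_residue N a : (n < N)%N -> (0 < a <= 6)%N ->
  qpoch (y ^+ a) (y ^+ 6) N =
  \prod_(k < n.+1) (if (0 < k)%N && (k %% 6 == a %% 6)%N then 1 - y ^+ k else 1).
Proof.
move=> nN a6; rewrite -(big_mkord xpredT (fun k : nat =>
  if (0 < k)%N && (k %% 6 == a %% 6)%N then 1 - y ^+ k else 1)).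
rewrite /qpoch -(big_mkord xpredT (fun i => 1 - y ^+ a * y ^+ 6 ^+ i)).
apply: (@big_support_bij _ _ _ _ _ _ _ [pred i | a + 6 * i < n.+1]%N
  [pred k | (0 < k) && (k %% 6 == a %% 6)]%N _ _ (fun i => a + 6 * i)%N (fun k => (k - a) %/ 6)%N).
- exact: iota_uniq.
- exact: iota_uniq.
- move=> i /= ia; rewrite -exprM -exprD (expr_nil_ge y0) ?subr0 //; lia.
- by move=> k /= /negbTE->.
- move=> i /= _ ia; have mE : ((a + 6 * i) %% 6 = a %% 6)%N by rewrite addnC mulnC modnMDl.
  rewrite mE eqxx addn_gt0 (proj1 (andP a6)) /= mem_index_iota; split=> //.
  by rewrite addKn mulKn.
  by rewrite -exprM -exprD.
- move=> k /=; rewrite !mem_index_iota => kn /andP[k0 /eqP ka].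
  have kE : (k = a + 6 * ((k - a) %/ 6))%N.
    by have := divn_eq k 6; have := divn_eq a 6; have := ltn_pmod k (isT : 0 < 6)%N; lia.
  by rewrite -kE; split => //; lia.
Qed.

Lemma part_gf_factor (k c : nat) : (k < n.+1)%N ->
  \sum_(v < n.+1) (part_weight k c v)%:~R * y ^+ (k * v) =
  if (0 < k)%N && (c < ncolours k)%N then
    if (k %% 6 == 0)%N then 1 - y ^+ k else geom n.+1 (y ^+ k)
  else 1 :> R.
Proof.
move=> kn; rewrite /part_weight; case: ifP => [/andP[k0 _]|_]; last first.
  by rewrite big_ord_recl big1 ?addr0 ?muln0 ?mulr1 // => i _; rewrite mul0r.
case: ifP => _; last first.
  by rewrite /geom; apply: eq_bigr => v _; rewrite if_same mul1r exprM.
case: n kn => [|n']; first by case: k k0.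
move=> _; rewrite 2!big_ord_recl big1 /= ?addr0 => [|i _]; last by rewrite oppr0 mul0r.
by rewrite muln0 muln1 expr0 mulr1 mulN1r.
Qed.

(** Factor by factor in the size k: an unrestricted part contributes
    1/(1 - y^k) for each of its colours, and a part divisible by 6, distinct and
    counted with sign -1, contributes 1 - y^k. *)
Lemma part_gf_product (f : {rmorphism {poly int} -> R}) N : f 'X = y -> (n < N)%N ->
  qpoch (y ^+ 3) (y ^+ 6) N * (qpoch y (y ^+ 6) N * qpoch (y ^+ 5) (y ^+ 6) N) ^+ 3 * f part_gf
  = qpoch (y ^+ 6) (y ^+ 6) N.
Proof.
move=> fX nN; have := qpoch_residue nN (isT : 0 < 1 <= 6)%N; rewrite expr1 => ->.
rewrite !qpoch_residue //.
have -> : f part_gf = \prod_(k < n.+1) \prod_(c < 3)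
    (if (0 < k)%N && (c < ncolours k)%N then
    if (k %% 6 == 0)%N then 1 - y ^+ k else geom n.+1 (y ^+ k)
  else 1).
  rewrite /part_gf rmorph_prod; apply: eq_bigr => k _.
  rewrite rmorph_prod; apply: eq_bigr => c _.
  rewrite rmorph_sum -part_gf_factor //; apply: eq_bigr => v _.
  by rewrite rmorphM rmorphXn fX -[part_weight _ _ _]intz !rmorph_int.
rewrite -[X in _ * X ^+ 3]big_split -prodrXl -!big_split /=; apply: eq_bigr => k _.
rewrite !big_ord_recl big_ord0 /ncolours /=.
case: posnP => [_|k0] /=; first by rewrite !(mulr1, expr1n).
have gP : (1 - y ^+ k) * geom n.+1 (y ^+ k) = 1.
  by case: (nat_of_ord k) k0 => // k' _; rewrite geomP ?nil_expS.
move: (geom _ _) gP => g gP.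
have := ltn_pmod k (isT : 0 < 6)%N.
case: (k %% 6)%N => [|[|[|[|[|[|?]]]]]] //= _; rewrite !(mulr1, mul1r, expr1n) //.
- by transitivity (((1 - y ^+ k) * g) ^+ 3); [ring | rewrite gP expr1n].
- by transitivity (((1 - y ^+ k) * g) ^+ 3); [ring | rewrite gP expr1n].
Qed.

End GeneratingFunction.

(** * Comparison of coefficients *)

Section Specialisation.
Variables (R : comNzRingType) (f : {rmorphism {poly int} -> R}) (n : nat).
Local Notation N := (2 * n).+1.
Hypothesis x0 : f 'X ^+ N = 0.

(** The partition polynomial is evaluated at the square of f 'X, through the
    morphism p -> f (p(X^2)). *)
Lemma lambda_even_eval : lambda_sum N (f 'X) + lambda_sum N (- f 'X) =
  2 * f (part_gf n \Po 'X^2).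
Proof.
have nX k : (0 < k)%N -> (f 'X ^+ k) ^+ N = 0 by exact: nil_exp.
pose g : {rmorphism {poly int} -> R} := f \o comp_poly 'X^2.
rewrite -[f (_ \Po _)]/(g (part_gf n)).
have gX : g 'X = f 'X ^+ 2 by rewrite /g /= comp_polyX rmorphXn.
have y0 : (f 'X ^+ 2) ^+ n.+1 = 0 by rewrite -exprM (expr_nil_ge x0) //; lia.
have nN : (n < N)%N by lia.
have := part_gf_product y0 gX nN; rewrite -!exprM => gf.
have := even_part x0; rewrite /odd_coprime3 -!exprM => ev.
apply: (qpoch_reg (nX 6 isT) (q := f 'X ^+ 12) (n := N)).
do 3 (apply: (qpoch_reg (nX 2 isT) (q := f 'X ^+ 12) (n := N));
      apply: (qpoch_reg (nX 10 isT) (q := f 'X ^+ 12) (n := N))).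
transitivity (2 * qpoch (f 'X ^+ 12) (f 'X ^+ 12) N); last by rewrite -gf; ring.
by rewrite -ev; ring.
Qed.

Definition lambda_even_poly : {poly int} :=
  \sum_(m < N) (P_lambda m * (1 + (-1) ^+ m))%:P * 'X^m.

Lemma lambda_even_polyE : f (lambda_even_poly - 2 * (part_gf n \Po 'X^2)) = 0.
Proof.
rewrite rmorphB rmorphM rmorph_nat -lambda_even_eval !lambda_sum_coef ?nil_opp //.
apply/eqP; rewrite subr_eq0 -big_split rmorph_sum; apply/eqP.
apply: eq_bigr => m _ /=; rewrite rmorphM rmorphXn.
rewrite -[X in X%:P]intz !rmorph_int.
rewrite intrM intrD rmorph_sign [(- _) ^+ m in RHS]exprNn; ring.
Qed.

End Specialisation.

Theorem theorem6p1 (n : nat) :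
  P_lambda (2 * n)%N =
  ((P_lambda_de n)%:Z - (P_lambda_do n)%:Z)%R.
Proof.
have nN : (2 * n < (2 * n).+1)%N by [].
have := lambda_even_polyE (in_qpolyX_nil (ltn0Sn (2 * n))).
move/(qpoly_coef_eq0 nN).
rewrite coefB mulr_natl coefMn coef_comp_poly_Xn // dvdn_mulr // mulKn //.
rewrite part_gf_coef coef_sum (bigD1 ord_max) //= coefCM coefXn eqxx mulr1.
rewrite big1 => [|m mn]; last first.
  by rewrite coefCM coefXn eq_sym (negbTE (_ : m != 2 * n :> nat)%N) ?mulr0.
rewrite -signr_odd oddM /= expr0; lia.
Qed.
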